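(* Let $G$ be either $\mathrm{SL}_2(\mathbb{R})$ or $\mathrm{SO}_3$, and $\mathfrak{g}$ its Lie algebra. Let $a(t)$ be a smoothly parametrized curve in $\mathfrak{g}$, defined on an interval containing $0$, with $|a(t)|$ non-vanishing, and let $g(t)\in G$ be the solution to $\dot g=ag$, $g(0)=\mathrm{I}$ (the identity). Set $A(t)=g(t)^{-1}\cdot a(t)=g(t)^{-1}a(t)g(t)$, and let $\mathbf{N}(t)=A(t)/|A(t)|$, $\mathbf{n}(t)=a(t)/|a(t)|$ be the corresponding normalized (pseudo) spherical curves in $\Sigma\subset\mathfrak{g}$. Then: (1) $g(t)$ rolls without slipping the curve $A(t)$ along $a(t)$ and $\mathbf{N}(t)$ along $\mathbf{n}(t)$. (2) If $|\dot{\mathbf{n}}|$ is non-vanishing then the geodesic curvatures $K,k$ of the (pseudo) spherical curves $\mathbf{N},\mathbf{n}$ (respectively) are related by $$K=k-\frac{|a|}{|\dot{\mathbf{n}}|}.$$ (3) $$\mathrm{Ad}_{g(t)}=\tilde P_{\mathbf{n}}(t)\circ R[\Phi(t)]\circ(\tilde P_{\mathbf{N}}(t))^{-1},$$ where $\tilde P_{\mathbf{n}}(t)$ is parallel transport $T_{\mathbf{n}(0)}\Sigma\to T_{\mathbf{n}(t)}\Sigma$ along $\mathbf{n}$, extended linearly to $\mathfrak{g}$ by $\mathbf{n}(0)\mapsto\mathbf{n}(t)$, similarly for $\tilde P_{\mathbf{N}}(t)$, and $R[\Phi(t)]$ is the (pseudo) rotation around the axis $a(0)$ by the angle $\Ph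i(t)=\int_0^t|a(\tau)|\,d\tau$.
   Context: $\mathfrak{g}$ is $\mathfrak{sl}_2(\mathbb{R})$ (traceless real $2\times2$ matrices) or $\mathfrak{so}_3$ (antisymmetric real $3\times3$ matrices), with $[a,b]=ab-ba$. $G$ acts on $\mathfrak{g}$ by $\mathrm{Ad}_g(a)=g\cdot a=gag^{-1}$. The $\mathrm{Ad}$-invariant inner product on $\mathfrak{g}$ is $\langle a,b\rangle=\lambda\,\mathrm{tr}(ab)$, with $\lambda=-\tfrac12$ for $\mathfrak{so}_3$ (positive definite) and $\lambda=2$ for $\mathfrak{sl}_2(\mathbb{R})$ (signature $(+,+,-)$); put $|a|=\sqrt{|\langle a,a\rangle|}$. $\Sigma$ is the unit (pseudo) sphere containing the curves: $S^2=\{a\in\mathfrak{so}_3:\langle a,a\rangle=1\}$ for $\mathfrak{so}_3$; for $\mathfrak{sl}_2(\mathbb{R})$, $H^2=\{a:\langle a,a\rangle=-1\}$ if $\langle a(t),a(t)\rangle<0$ and $H^{1,1}=\{a:\langle a,a\rangle=1\}$ if $\langle a(t),a(t)\rangle>0$. A dot denotes $d/dt$. Rolling without slipping: for parametrized curves $\Gamma(t),\gamma(t)$ in $\mathfrak{g}$, a curve $g(t)$ in $G$ rolls $\Gamma$ along $\gamma$ without slipping if $g(t)\cdot\Gamma(t)=\gamma(t)$ and $g(t)\cdot\dot\Gamma(t)=\dot\gamma(t)$ for all $t$. Geodesic curvature: for a curve $\gamma(t)$ in $\Sigma$ with $|\dot\gamma|$ non-vanishing, let a prime denote the derivative with respect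 to arc length, $\gamma'=\dot\gamma/|\dot\gamma|$. Then $(\gamma,\gamma',[\gamma,\gamma'])$ is an orthonormal frame along $\gamma$, and the geodesic curvature of $\gamma$ is the coefficient of $[\gamma,\gamma']$ when $\gamma''$ is written as a linear combination of $\gamma,\gamma',[\gamma,\gamma']$. Parallel transport: a vector field $v(t)\in T_{\gamma(t)}\Sigma=\gamma(t)^\perp$ along $\gamma$ is parallel if $\dot v(t)$ is a multiple of $\gamma(t)$ for all $t$. Parallel transport along $\gamma$ is the isometry $T_{\gamma(0)}\Sigma\to T_{\gamma(t)}\Sigma$, $v(0)\mapsto v(t)$, for parallel $v$. (Pseudo) rotation: $R[\Phi]$ around $a(0)$ is the linear map of $\mathfrak{g}$ fixing $\mathbf{n}(0)$ and acting on $v\in\mathbf{n}(0)^\perp=T_{\mathbf{n}(0)}\Sigma$ by $v\mapsto(\cos\Phi)v+(\sin\Phi)[\mathbf{n}(0),v]$ if $\Sigma=S^2$ or $H^2$, and by $v\mapsto(\cosh\Phi)v+(\sinh\Phi)[\mathbf{n}(0),v]$ if $\Sigma=H^{1,1}$. *)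

(* Defs.v *)
From mathcomp Require Import all_boot all_order all_algebra.
From mathcomp Require Import all_classical all_reals all_analysis.

Set Implicit Arguments.
Unset Strict Implicit.
Unset Printing Implicit Defensive.

Import Order.TTheory GRing.Theory Num.Theory.
Import numFieldNormedType.Exports.

Local Open Scope classical_set_scope.
Local Open Scope ring_scope.

(* Derivatives along a curve [f : J -> V], where [J] is an interval of any kind.
   The difference quotient only sees points of [J], so the values of [f] outside
   [J] are irrelevant: at an interior point this is the usual derivative, at an
   endpoint belonging to [J] it is the one-sided one. *)
Section Curves.
Context {R : realType} {V : normedModType R}.
Implicit Types (J : set R) (f : R -> V) (t : R).

Definition diff_quotient f t : R -> V := fun s => (s - t)^-1 *: (f s - f t).

Definition derivable_in J f t : Prop :=
  cvg (diff_quotient f t @ within J t^').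

Definition ddt J f t : V := lim (diff_quotient f t @ within J t^').

Definition smooth_on J f : Prop :=
  forall (k : nat) t, J t -> derivable_in J (iter k (ddt J) f) t.

End Curves.

Section Functions.
Context {R : realType}.
Implicit Types (f : R -> R) (x : R).

Definition cosh x : R := (expR x + expR (- x)) / 2.
Definition sinh x : R := (expR x - expR (- x)) / 2.

(* [oint f t] is the oriented integral from 0 to t, t of either sign. *)
Definition oint f t : R :=
  if 0 <= t then \int[lebesgue_measure]_(x in `[0, t]) f x
  else - \int[lebesgue_measure]_(x in `[t, 0]) f x.

End Functions.

Inductive lie_group := SL2 | SO3.

Inductive pseudosphere := Sphere2 | Hyperbolic2 | Hyperbolic11.

Definition msize (G : lie_group) : nat :=
  match G with SL2 => 2 | SO3 => 3 end.

Section Geometry.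
Context {R : realType}.
Variable G : lie_group.
Local Notation M := 'M[R]_(msize G).
Implicit Types (J : set R) (x y v : M) (a g c u : R -> M).

Definition in_group (h : M) : Prop :=
  match G with
  | SL2 => \det h = 1
  | SO3 => h^T *m h = 1%:M /\ \det h = 1
  end.

Definition in_algebra : set M :=
  match G with
  | SL2 => [set x | \tr x = 0]
  | SO3 => [set x | x^T = - x]
  end.

Definition bracket x y : M := x *m y - y *m x.

Definition Ad (h x : M) : M := h *m x *m invmx h.

Definition lambda : R := match G with SL2 => 2 | SO3 => - 2^-1 end.

Definition inner x y : R := lambda * \tr (x *m y).

Definition norm x : R := Num.sqrt `|inner x x|.

Definition normalize c : R -> M := fun t => (norm (c t))^-1 *: c t.

Definition sphere (S : pseudosphere) : set M :=
  in_algebra `&`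
  match S with
  | Sphere2 | Hyperbolic11 => [set x | inner x x = 1]
  | Hyperbolic2 => [set x | inner x x = - 1]
  end.

(* The pseudosphere in the direction of a vector [x] with [norm x != 0]. *)
Definition sphere_of x : pseudosphere :=
  match G with
  | SO3 => Sphere2
  | SL2 => if inner x x < 0 then Hyperbolic2 else Hyperbolic11
  end.

Definition solves J a g : Prop :=
  [/\ forall t, J t -> in_group (g t),
      forall t, J t -> derivable_in J g t /\ ddt J g t = a t *m g t
    & g 0 = 1%:M].

Definition rolls J g c1 c2 : Prop :=
  forall t, J t ->
    [/\ in_group (g t),
        derivable_in J c1 t /\ derivable_in J c2 t,
        Ad (g t) (c1 t) = c2 t
      & Ad (g t) (ddt J c1 t) = ddt J c2 t].

(* Arc length derivative, along the curve [c], of a curve [f]. *)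
Definition dds J c f : R -> M := fun t => (norm (ddt J c t))^-1 *: ddt J f t.

Definition geodesic_curvature J c (t : R) : R :=
  let c' := dds J c c in
  xget 0 [set k | exists p q : R,
    dds J c c' t = p *: c t + q *: c' t + k *: bracket (c t) (c' t)].

(* The tangent space at [p] of the pseudosphere through [p]. *)
Definition tangent (p : M) : set M := in_algebra `&` [set v | inner p v = 0].

Definition parallel J c u : Prop :=
  forall t, J t ->
    [/\ tangent (c t) (u t), derivable_in J u t
      & exists m : R, ddt J u t = m *: c t].

(* [P t] is parallel transport from [c 0] to [c t]. *)
Definition parallel_transport J c (P : R -> M -> M) : Prop :=
  forall w, tangent (c 0) w -> P 0 w = w /\ parallel J c (P ^~ w).

(* Linear extension to the Lie algebra, by [p |-> q], of a linear map [f] defined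
   on the orthogonal complement of [p]; here [inner p p != 0]. *)
Definition lin_ext (p q : M) (f : M -> M) : M -> M :=
  fun x => let r := inner p x / inner p p in r *: q + f (x - r *: p).

Definition transport_ext c (P : R -> M -> M) (t : R) : M -> M :=
  lin_ext (c 0) (c t) (P t).

Definition rotation (S : pseudosphere) (p : M) (phi : R) : M -> M :=
  lin_ext p p (fun v =>
    match S with
    | Sphere2 | Hyperbolic2 => cos phi *: v + sin phi *: bracket p v
    | Hyperbolic11 => cosh phi *: v + sinh phi *: bracket p v
    end).

End Geometry.

Arguments in_algebra {R} G.
Arguments sphere {R} G S.

(* Main.v *)
Require Import Defs.
From mathcomp Require Import all_boot all_order all_algebra.
From mathcomp Require Import all_classical all_reals all_analysis.
From mathcomp Require Import ring lra.

Import Order.TTheory GRing.Theory Num.Theory.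
Import numFieldNormedType.Exports.

Set Implicit Arguments.
Unset Strict Implicit.
Unset Printing Implicit Defensive.

Local Open Scope classical_set_scope.
Local Open Scope ring_scope.

(** Conjugation by the inverse of [g] turns a derivative [x'] into [x' - [a, x]], so it
    commutes with differentiation along [a] and [n], both of which commute with [a]: this is
    rolling.  On [n''] it produces the extra term [- [a, n']], which is the curvature defect.
    A field [V] parallel along [N] becomes [W = g V], whose derivative is [|a| [n, W]] up to
    a multiple of [n]; rotating [W] by the angle [- Phi] in the tangent plane cancels this
    term and yields a field parallel along [n].  Parallel fields are determined by their
    initial value because, for one non-null parallel [E], the field [[n, E]] is parallel too
    and the inner products with [E] and [[n, E]] are constant; no uniqueness theorem for
    differential equations is needed. *)

(** * The Lie algebras *)

(** The two algebras enter through the triple product [[x, [y, z]] = s (<x, y> z - <x, z> y)], with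
    [s = 1] for [sl_2] and [s = -1] for [so_3]. It makes [[n, .]] square to [d = s <n, n>] on the
    tangent plane: [-1] on the sphere and the hyperbolic plane, [1] on [H^{1,1}]. This [d] decides
    between circular and hyperbolic functions, and one computation serves all three surfaces. Two
    obstacles shape the rest. The interval may contain its endpoints, so derivatives are taken
    within it, and their calculus is developed far enough to differentiate [oint] and to conclude
    constancy from a zero derivative. The inner product may be indefinite, so frames must avoid null
    vectors, and orthogonal expansions rest on the triple product instead of positivity. *)

Section LieAlgebra.
Context {R : realType}.
Variable G : lie_group.
Local Notation M := 'M[R]_(msize G).
Local Notation alg := (@in_algebra R G).
Implicit Types (x y z h : M).

(** The sign in the triple product formula of [double_bracket]; its value reflects the normalisation
    [lambda]. *)
Definition lie_sign : R := match G with SL2 => 1 | SO3 => - 1 end.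

Lemma lie_sign_sqr : lie_sign * lie_sign = 1.
Proof. by rewrite /lie_sign; case: G; rewrite ?mulrNN mulr1. Qed.

Lemma algD x y : alg x -> alg y -> alg (x + y).
Proof.
rewrite /in_algebra; case: G x y => /= x y hx hy.
  by rewrite mxtraceD hx hy addr0.
by rewrite linearD /= hx hy opprD.
Qed.

Lemma algZ k x : alg x -> alg (k *: x).
Proof.
rewrite /in_algebra; case: G x => /= x hx.
  by rewrite mxtraceZ hx mulr0.
by rewrite linearZ /= hx scalerN.
Qed.

Lemma algB x y : alg x -> alg y -> alg (x - y).
Proof. by move=> hx hy; rewrite -scaleN1r; apply: algD => //; exact: algZ. Qed.

Lemma alg_bracket x y : alg x -> alg y -> alg (bracket x y).
Proof.
rewrite /in_algebra /bracket; case: G x y => /= x y hx hy.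
  by rewrite linearB /= mxtrace_mulC subrr.
by rewrite linearB /= !trmx_mul hx hy !mulNmx !mulmxN !opprK opprB.
Qed.

Lemma innerC x y : inner x y = inner y x.
Proof. by rewrite /inner mxtrace_mulC. Qed.

Lemma innerDr x y z : inner x (y + z) = inner x y + inner x z.
Proof. by rewrite /inner mulmxDr mxtraceD mulrDr. Qed.

Lemma innerZr k x y : inner x (k *: y) = k * inner x y.
Proof. by rewrite /inner -scalemxAr mxtraceZ mulrCA. Qed.

Lemma innerNr x y : inner x (- y) = - inner x y.
Proof. by rewrite -scaleN1r innerZr mulN1r. Qed.

Lemma innerBr x y z : inner x (y - z) = inner x y - inner x z.
Proof. by rewrite innerDr innerNr. Qed.

Lemma innerDl x y z : inner (y + z) x = inner y x + inner z x.
Proof. by rewrite innerC innerDr ![inner x _]innerC. Qed.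

Lemma innerZl k x y : inner (k *: x) y = k * inner x y.
Proof. by rewrite innerC innerZr innerC. Qed.

Lemma inner0r x : inner x 0 = 0.
Proof. by rewrite -(scale0r 0) innerZr mul0r. Qed.

Lemma bracketDr x y z : bracket x (y + z) = bracket x y + bracket x z.
Proof. by rewrite /bracket mulmxDr mulmxDl opprD addrACA. Qed.

Lemma bracketZr k x y : bracket x (k *: y) = k *: bracket x y.
Proof. by rewrite /bracket -scalemxAr -scalemxAl scalerBr. Qed.

Lemma bracketBr x y z : bracket x (y - z) = bracket x y - bracket x z.
Proof. by rewrite bracketDr -scaleN1r bracketZr scaleN1r. Qed.

Lemma bracketC x y : bracket x y = - bracket y x.
Proof. by rewrite /bracket opprB. Qed.

Lemma bracketZl k x y : bracket (k *: x) y = k *: bracket x y.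
Proof. by rewrite bracketC bracketZr -scalerN -bracketC. Qed.

Lemma bracketxx x : bracket x x = 0.
Proof. exact: subrr. Qed.

Lemma bracketx0 x : bracket x 0 = 0.
Proof. by rewrite -(scale0r (0 : M)) bracketZr !scale0r. Qed.

Lemma inner_bracketl x y z : inner (bracket x y) z = - inner y (bracket x z).
Proof.
rewrite /inner -mulrN; congr (_ * _); rewrite /bracket mulmxBl mulmxBr.
have trB (u v : M) : \tr (u - v) = \tr u - \tr v by exact: linearB.
rewrite !trB opprB [\tr (x *m y *m z)]mxtrace_mulC mulmxA.
rewrite [\tr (y *m (x *m z))]mxtrace_mulC -[y *m x *m z]mulmxA.
by rewrite [\tr (y *m (x *m z))]mxtrace_mulC [\tr (y *m (z *m x))]mxtrace_mulC.
Qed.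

Lemma inner_bracketxl x y : inner x (bracket x y) = 0.
Proof. by rewrite -[RHS]oppr0 -(inner0r y) -(bracketxx x) innerC inner_bracketl. Qed.

Lemma inner_bracketxr x y : inner y (bracket x y) = 0.
Proof. by rewrite bracketC innerNr inner_bracketxl oppr0. Qed.

Lemma forall_ord2 (P : 'I_2 -> Prop) :
  P ord0 -> P (lift ord0 ord0) -> forall i, P i.
Proof.
move=> P0 P1 i; case: (unliftP ord0 i) => [j ->|-> //].
by rewrite ord1.
Qed.

Lemma forall_ord3 (P : 'I_3 -> Prop) :
  P ord0 -> P (lift ord0 ord0) -> P (lift ord0 (lift ord0 ord0)) ->
  forall i, P i.
Proof.
move=> P0 P1 P2 i; case: (unliftP ord0 i) => [j ->|-> //].
by move: j; exact: forall_ord2.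
Qed.

(** For [so_3] this is the vector triple product, the bracket being the cross product. In both cases
    it is a polynomial identity in the entries once tracelessness or antisymmetry has removed the
    dependent ones. *)
Lemma double_bracket x y z : alg x -> alg y -> alg z ->
  bracket x (bracket y z) = lie_sign *: (inner x y *: z - inner x z *: y).
Proof.
rewrite /lie_sign /in_algebra /bracket /inner /lambda.
case: G x y z => /= x y z.
  rewrite /mxtrace !big_ord_recl !big_ord0 /= => hx hy hz.
  have tr (u : 'M[R]_2) : u ord0 ord0 + (u (lift ord0 ord0) (lift ord0 ord0) + 0) = 0 ->
    u (lift ord0 ord0) (lift ord0 ord0) = - u ord0 ord0 by lra.
  apply/matrixP; apply: forall_ord2; apply: forall_ord2;
  rewrite !(mxE, big_ord_recl, big_ord0); rewrite (tr x hx) (tr y hy) (tr z hz); ring.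
rewrite /mxtrace => hx hy hz.
pose i1 := lift ord0 ord0 : 'I_3; pose i2 := lift ord0 (lift ord0 ord0) : 'I_3.
have skew (u : 'M[R]_3) : u^T = - u ->
    [/\ u ord0 ord0 = 0, u i1 i1 = 0 & u i2 i2 = 0] /\
    [/\ u i1 ord0 = - u ord0 i1, u i2 ord0 = - u ord0 i2 & u i2 i1 = - u i1 i2].
  move=> /matrixP hu; have as_ i j : u i j = - u j i.
    by have := hu j i; rewrite !mxE.
  have as0 i : u i i = 0 by have := as_ i i; lra.
  by split; split.
have [[x0 x1 x2] [x3 x4 x5]] := skew x hx.
have [[y0 y1 y2] [y3 y4 y5]] := skew y hy.
have [[z0 z1 z2] [z3 z4 z5]] := skew z hz.
by apply/matrixP; apply: forall_ord3; apply: forall_ord3;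
  rewrite !(mxE, big_ord_recl, big_ord0) -/i1 -/i2;
  rewrite !(x0, x1, x2, x3, x4, x5, y0, y1, y2, y3, y4, y5)
    !(z0, z1, z2, z3, z4, z5); field.
Qed.

(** Only Pythagoras' formula in an orthonormal basis is kept, with the signs of the signature; it
    serves to find non-null tangent vectors. *)
Lemma orthonormal_basis_expansion : exists e1 e2 e3 : M, exists s1 s2 s3 : R,
  [/\ alg e1, alg e2 & alg e3] /\ forall x, alg x ->
    [/\ inner e1 e1 = s1, inner e2 e2 = s2 & inner e3 e3 = s3] /\
    [/\ s1 * s1 = 1, s2 * s2 = 1, s3 * s3 = 1 &
       inner x x = s1 * inner x e1 ^+ 2 + s2 * inner x e2 ^+ 2 + s3 * inner x e3 ^+ 2].
Proof.
rewrite /inner /in_algebra /lambda; case: G => /=.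
  pose E i j : 'M[R]_2 := delta_mx i j; pose k := lift ord0 ord0 : 'I_2.
  (* The factors 1/2 compensate for [lambda = 2]; the antisymmetric matrix is the negative
     direction. *)
  exists (2^-1 *: (E ord0 ord0 - E k k)), (2^-1 *: (E ord0 k + E k ord0)),
    (2^-1 *: (E ord0 k - E k ord0)), 1, 1, (-1).
  rewrite /mxtrace; split.
    by split; rewrite !big_ord_recl big_ord0 !mxE /=; ring.
  move=> x; rewrite !big_ord_recl !big_ord0 /= => hx.
  have {hx}tr : x k k = - x ord0 ord0 by rewrite /k; lra.
  rewrite !(mxE, big_ord_recl, big_ord0) /=; rewrite -/k tr.
  by split; split; field.
pose E i j : 'M[R]_3 := delta_mx i j; pose i1 := lift ord0 ord0 : 'I_3.
pose i2 := lift ord0 (lift ord0 ord0) : 'I_3.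
exists (E ord0 i1 - E i1 ord0), (E ord0 i2 - E i2 ord0), (E i1 i2 - E i2 i1), 1, 1, 1.
split.
  by split; rewrite linearB /= !trmx_delta opprB.
move=> x /matrixP hx.
have as_ i j : x i j = - x j i by have := hx j i; rewrite !mxE.
have as0 i : x i i = 0 by have := as_ i i; lra.
rewrite /mxtrace.
rewrite !(mxE, big_ord_recl, big_ord0) /=; rewrite -/i1 -/i2.
rewrite !as0 !(as_ i1 ord0) !(as_ i2 ord0) !(as_ i2 i1).
by split; split; field.
Qed.

End LieAlgebra.

(** * Orthogonal frames and the adjoint action *)

Section FramesAndAdjointAction.
Context {R : realType}.
Variable G : lie_group.
Local Notation M := 'M[R]_(msize G).
Local Notation alg := (@in_algebra R G).
Local Notation s := (@lie_sign R G).
Implicit Types (x y z h n e : M).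

Lemma lie_sign_neq0 : s != 0.
Proof. by rewrite /lie_sign; case: G; rewrite ?oppr_eq0 oner_eq0. Qed.

Lemma inner_bracket2 n x y : alg n -> alg x -> alg y ->
  inner (bracket n x) (bracket n y) = s * (inner n x * inner n y - inner n n * inner x y).
Proof.
move=> hn hx hy; rewrite inner_bracketl double_bracket// innerZr innerBr !innerZr.
by rewrite (innerC x n) (mulrC (inner n y)) -mulrN opprB.
Qed.

(** With [f = [n, e]], the bracket [[f, z]] vanishes by the triple product, whereas [[f, [f, z]]] is
    [<f, f> z] up to sign and [<f, f>] is not 0. This replaces a dimension count. *)
Lemma orthogonal_frame_eq0 n e z : alg n -> alg e -> alg z ->
  inner n n != 0 -> inner e e != 0 -> inner n e = 0 ->
  inner n z = 0 -> inner e z = 0 -> inner (bracket n e) z = 0 -> z = 0.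
Proof.
move=> hn he hz nn ee ne nz ez fz; have hf := alg_bracket hn he.
have : bracket (bracket n e) (bracket (bracket n e) z) = 0.
  rewrite (bracketC _ z) double_bracket// (innerC z n) (innerC z e) nz ez.
  by rewrite !scale0r subrr scaler0 oppr0 bracketx0.
rewrite double_bracket// fz scale0r subr0 scalerA => /eqP.
rewrite scaler_eq0 inner_bracket2// ne mul0r sub0r mulrN mulrN mulrA lie_sign_sqr.
by rewrite mul1r oppr_eq0 mulf_eq0 (negbTE nn) (negbTE ee) /= => /eqP.
Qed.

Lemma inner_frame n e : alg n -> alg e -> inner n e = 0 ->
  inner (bracket n e) (bracket n e) = - (s * (inner n n * inner e e)).
Proof. by move=> hn he ne; rewrite inner_bracket2// ne mul0r sub0r mulrN. Qed.

Lemma inner_frame_neq0 n e : alg n -> alg e -> inner n e = 0 ->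
  inner n n != 0 -> inner e e != 0 ->
  inner (bracket n e) (bracket n e) != 0.
Proof.
move=> hn he ne nn ee; rewrite inner_frame// oppr_eq0.
by rewrite mulf_eq0 (negbTE lie_sign_neq0) mulf_eq0 (negbTE nn) (negbTE ee).
Qed.

Lemma frame_expansion n e z : alg n -> alg e -> alg z ->
  inner n n != 0 -> inner e e != 0 -> inner n e = 0 ->
  z = (inner n z / inner n n) *: n + (inner e z / inner e e) *: e
    + (inner (bracket n e) z / inner (bracket n e) (bracket n e)) *: bracket n e.
Proof.
move=> hn he hz nn ee ne; apply/eqP; rewrite -subr_eq0; apply/eqP.
have hf := alg_bracket hn he.
have ff := inner_frame_neq0 hn he ne nn ee.
have := inner_bracketxl n e; have := inner_bracketxr n e.
have := orthogonal_frame_eq0 hn he; move: (bracket n e) hf ff => f hf ff H ef nf.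
apply: H => //.
- by apply: algB => //; do 2?[apply: algD]; apply: algZ.
- by rewrite innerBr !innerDr !innerZr ne nf; field; rewrite nn ee ff.
- by rewrite innerBr !innerDr !innerZr (innerC e n) ne ef; field; rewrite nn ee ff.
- rewrite innerBr !innerDr !innerZr (innerC f n) (innerC f e) nf ef.
  by field; rewrite nn ee ff.
Qed.

(** The triple product gives [[n, z] = 0] for [z = [x, y]]; expanding [[n, [n, z]] = 0] in turn
    shows that [z] is along [n]. *)
Lemma bracket_orthogonal n x y : alg n -> alg x -> alg y -> inner n n != 0 ->
  inner n x = 0 -> inner n y = 0 -> exists m, bracket x y = m *: n.
Proof.
move=> hn hx hy nn nx ny; have hz := alg_bracket hx hy.
have := double_bracket hn hn hz.
rewrite (double_bracket hn hx hy) nx ny !scale0r subrr scaler0 bracketx0.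
move=> /esym/eqP; rewrite scaler_eq0 => /orP[|].
  by rewrite (negbTE lie_sign_neq0).
rewrite subr_eq0 => /eqP e; exists (inner n (bracket x y) / inner n n).
by rewrite mulrC -scalerA -e scalerA mulVf// scale1r.
Qed.

(** On [H^{1,1}] the tangent plane contains null vectors, so a frame vector has to be selected. The
    candidates are the brackets of [n] with an orthonormal basis. *)
Lemma exists_nonnull_orthogonal n : alg n -> inner n n != 0 ->
  exists e, [/\ alg e, inner n e = 0 & inner e e != 0].
Proof.
move=> hn nn; have [e1 [e2 [e3 [s1 [s2 [s3 [[h1 h2 h3] H]]]]]]] :=
  @orthonormal_basis_expansion R G.
have [[E1 E2 E3] [S1 S2 S3 Hn]] := H n hn.
have null e : alg e -> inner (bracket n e) (bracket n e) = 0 ->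
    inner n e ^+ 2 = inner n n * inner e e.
  move=> he; rewrite inner_bracket2// => /eqP; rewrite mulf_eq0 => /orP[|].
    by rewrite (negbTE lie_sign_neq0).
  by rewrite subr_eq0 => /eqP <-; rewrite expr2.
have nonnull e : alg e -> inner (bracket n e) (bracket n e) != 0 ->
    exists e', [/\ alg e', inner n e' = 0 & inner e' e' != 0].
  move=> he; exists (bracket n e); split => //; first exact: alg_bracket.
  exact: inner_bracketxl.
have [z1|] := eqVneq (inner (bracket n e1) (bracket n e1)) 0; last exact: nonnull.
have [z2|] := eqVneq (inner (bracket n e2) (bracket n e2)) 0; last exact: nonnull.
have [z3|] := eqVneq (inner (bracket n e3) (bracket n e3)) 0; last exact: nonnull.
(* If all three were null, Pythagoras would read <n,n> = 3 <n,n>. *)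
exfalso; move: Hn nn; rewrite !null// E1 E2 E3 !(mulrCA _ (inner n n)) S1 S2 S3.
by move=> ? /eqP; lra.
Qed.

Lemma norm_neq0 x : (norm x != 0) = (inner x x != 0).
Proof. by rewrite /norm sqrtr_eq0 -ltNge normr_gt0. Qed.

Lemma sqr_norm x : norm x ^+ 2 = `|inner x x|.
Proof. by rewrite sqr_sqrtr. Qed.

Lemma inner_normalized x : norm x != 0 ->
  inner ((norm x)^-1 *: x) ((norm x)^-1 *: x) = Num.sg (inner x x).
Proof.
move=> nx; rewrite innerZl innerZr mulrA -expr2 exprVn sqr_norm.
by rewrite {2}(numEsg (inner x x)) mulrCA mulVf ?mulr1// normr_eq0 -norm_neq0.
Qed.

Lemma group_unit h : in_group h -> h \in unitmx.
Proof.
rewrite /in_group unitmxE; case: G h => /= h; first by move=> ->; rewrite unitr1.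
by move=> [_ ->]; rewrite unitr1.
Qed.

(* The inverse of a group element is linear in its entries, hence differentiable. *)
Definition ginv : M -> M :=
  match G return 'M[R]_(msize G) -> 'M[R]_(msize G) with
  | SL2 => fun u => (\tr u)%:M - u
  | SO3 => fun u => u^T
  end.

(** For 2 x 2 matrices [tr(h) I - h] is the adjugate, which is the inverse when the determinant is
    1. *)
Lemma invmx_ginv h : in_group h -> invmx h = ginv h.
Proof.
move=> hg; suff e : ginv h *m h = 1%:M.
  by rewrite -[LHS]mul1mx -e -mulmxA mulmxV ?mulmx1// group_unit.
move: hg; rewrite /in_group /ginv; case: G h => /= h; last by case.
have e1 : lift ord0 0 = lift ord0 ord0 :> 'I_2 by exact: val_inj.
have e2 : lift (lift ord0 ord0) 0 = ord0 :> 'I_2 by exact: val_inj.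
rewrite (expand_det_row h ord0) !big_ord_recl big_ord0 /cofactor !det_mx11 => hg.
apply/matrixP; apply: forall_ord2; apply: forall_ord2.
all: rewrite /mxtrace !(mxE, big_ord_recl, big_ord0) /=.
all: move: hg; rewrite !mxE /= ?expr0 ?expr1 ?mulr1n ?mulr0n e1 e2.
- by move=> <-; ring.
- by move=> _; ring.
- by move=> _; ring.
- by move=> <-; ring.
Qed.

Lemma in_group_inv h : in_group h -> in_group (invmx h).
Proof.
rewrite /in_group; case: G h => /= h; first by rewrite det_inv => ->; rewrite invr1.
move=> [hT dh]; have hu : h \in unitmx by rewrite unitmxE dh unitr1.
have -> : invmx h = h^T by rewrite -[LHS]mul1mx -hT -mulmxA mulmxV ?mulmx1.
by rewrite trmxK det_tr; split => //; exact: mulmx1C.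
Qed.

Lemma AdD h x y : Ad h (x + y) = Ad h x + Ad h y.
Proof. by rewrite /Ad mulmxDr mulmxDl. Qed.

Lemma AdZ h k x : Ad h (k *: x) = k *: Ad h x.
Proof. by rewrite /Ad -scalemxAr -scalemxAl. Qed.

Lemma AdB h x y : Ad h (x - y) = Ad h x - Ad h y.
Proof. by rewrite AdD -scaleN1r AdZ scaleN1r. Qed.

Lemma AdK h x : h \in unitmx -> Ad (invmx h) (Ad h x) = x.
Proof.
by move=> hu; rewrite /Ad invmxK !mulmxA mulVmx// mul1mx -mulmxA mulVmx// mulmx1.
Qed.

Lemma AdKV h x : h \in unitmx -> Ad h (Ad (invmx h) x) = x.
Proof.
by move=> hu; rewrite -{1}[h]invmxK AdK// unitmx_inv.
Qed.

Lemma Ad_mulmx h x y : h \in unitmx -> Ad h (x *m y) = Ad h x *m Ad h y.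
Proof. by move=> hu; rewrite /Ad !mulmxA -[_ *m invmx h *m h]mulmxA mulVmx// mulmx1. Qed.

Lemma Ad_bracket h x y : h \in unitmx -> Ad h (bracket x y) = bracket (Ad h x) (Ad h y).
Proof. by move=> hu; rewrite /bracket AdB !Ad_mulmx. Qed.

Lemma Ad_inner h x y : h \in unitmx -> inner (Ad h x) (Ad h y) = inner x y.
Proof.
by move=> hu; rewrite /inner -Ad_mulmx// /Ad mxtrace_mulC mulKmx.
Qed.

Lemma Ad_norm h x : h \in unitmx -> norm (Ad h x) = norm x.
Proof. by move=> hu; rewrite /norm Ad_inner. Qed.

Lemma Ad_alg h x : in_group h -> alg x -> alg (Ad h x).
Proof.
move=> hg; have hu := group_unit hg; have := invmx_ginv hg; rewrite /Ad.
move: hg hu; rewrite /in_group /in_algebra /ginv; case: G h x => /= h x hg hu hi hx.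
  by rewrite mxtrace_mulC mulKmx.
by rewrite hi !trmx_mul trmxK hx mulNmx mulmxN mulmxA.
Qed.

End FramesAndAdjointAction.

(** * Differentiation within an interval *)

(** Asserts convergence together with the value, whereas [ddt] is a [lim] that is meaningful only
    under [derivable_in]. *)
Definition has_ddt {R : realType} {V : normedModType R} (J : set R) (f : R -> V)
  (t : R) (d : V) : Prop := diff_quotient f t @ within J t^' --> d.

Section HasDdt.
Context {R : realType}.
Implicit Types (J : set R) (t : R).

(** Properness of this filter is what makes derivatives unique. Points of [J] accumulate at [t]
    because the segment from [t] to [u] lies in [J]. *)
Lemma within_dnbhs_proper J t u : is_interval J -> J t -> J u -> u != t ->
  ProperFilter (within J t^').
Proof.
move=> hJ Jt Ju ut; apply: Build_ProperFilter_ex.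
move=> P /nbhs_ballP[e /= e0 he].
(* Small enough to stay in the ball of radius [e] and not to pass [u]. *)
pose d := Num.min (e / 2) `|u - t|.
have d0 : 0 < d by rewrite lt_min divr_gt0//= normr_gt0 subr_eq0.
have de : d < e by rewrite gt_min ltr_pdivrMr// mulr_natr mulr2n ltrDr e0.
have du : d <= `|u - t| by rewrite ge_min lexx orbT.
have [tu|ut'] := ltP t u.
  exists (t + d); apply: he => /=.
  - by rewrite /ball /= opprD addrA subrr sub0r normrN gtr0_norm.
  - by rewrite gt_eqF// ltrDl.
  - apply: (hJ t u) => //; rewrite lerDl ltW//=.
    by move: du; rewrite gtr0_norm ?subr_gt0//; lra.
exists (t - d); apply: he => /=.
- by rewrite /ball /= opprB addrCA subrr addr0 gtr0_norm.
- by rewrite lt_eqF// gtrDl oppr_lt0.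
- apply: (hJ u t) => //; rewrite gerDl oppr_le0 (ltW d0) andbT.
  by move: du; rewrite ler0_norm ?subr_le0//; lra.
Qed.

Section Module.
Context {V : normedModType R}.
Implicit Types (f g : R -> V) (d : V).

Lemma derivable_inP J f t : derivable_in J f t -> has_ddt J f t (ddt J f t).
Proof. by move=> /cvg_ex[l hl]; apply: cvgP hl. Qed.

Lemma has_ddt_derivable J f t d : has_ddt J f t d -> derivable_in J f t.
Proof. by move=> h; apply/cvg_ex; exists d. Qed.

Lemma has_ddt_ext J f g t d : J t -> (forall u, J u -> f u = g u) ->
  has_ddt J f t d -> has_ddt J g t d.
Proof.
move=> Jt fg; apply: cvg_trans; apply: near_eq_cvg.
by near=> u; rewrite /diff_quotient !fg//; near: u; exact: withinT.
Unshelve. all: by end_near. Qed.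

Lemma has_ddt_cst J t (c : V) : has_ddt J (fun=> c) t 0.
Proof.
rewrite /has_ddt (_ : diff_quotient _ _ = fun=> 0) ?cvg_cst//.
  exact: cvg_cst.
by apply/funext => u; rewrite /diff_quotient subrr scaler0.
Qed.

Lemma has_ddtD J f g t df dg : has_ddt J f t df -> has_ddt J g t dg ->
  has_ddt J (fun u => f u + g u) t (df + dg).
Proof.
move=> hf hg; rewrite /has_ddt (_ : diff_quotient _ _ =
  fun u => diff_quotient f t u + diff_quotient g t u).
  exact: cvgD.
by apply/funext => u; rewrite /diff_quotient -scalerDr opprD addrACA.
Qed.

Lemma has_ddt_sum J n (f : 'I_n -> R -> V) t df :
  (forall i, has_ddt J (f i) t (df i)) ->
  has_ddt J (fun u => \sum_i f i u) t (\sum_i df i).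
Proof.
elim: n f df => [|n IH] f df hf.
  rewrite (_ : (fun u => _) = fun=> 0) ?big_ord0; first exact: has_ddt_cst.
  by apply/funext => u; rewrite big_ord0.
rewrite (_ : (fun u => _) = fun u => f ord0 u + \sum_i f (lift ord0 i) u).
  rewrite big_ord_recl; apply: has_ddtD => //.
  by apply: IH => i.
by apply/funext => u; rewrite big_ord_recl.
Qed.

Lemma has_ddt_cvg J f t d : has_ddt J f t d -> f @ within J t^' --> f t.
Proof.
move=> hf.
have h : (fun u => (u - t) *: diff_quotient f t u) @ within J t^' --> (0 : R) *: d.
  apply: cvgZ => //; rewrite -(subrr t); apply: cvgB; last exact: cvg_cst.
  by apply: cvg_trans (cvg_within _) _; exact: nbhs_dnbhs.
have {}h : (fun u => (u - t) *: diff_quotient f t u + f t) @ within J t^' --> f t.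
  by rewrite -[X in _ --> X]add0r -(scale0r d); apply: cvgD => //; exact: cvg_cst.
apply: cvg_trans h; apply: near_eq_cvg; near=> u.
rewrite /diff_quotient scalerA divff ?scale1r ?subrK// subr_eq0.
by near: u; apply: cvg_within; exact: withinT.
Unshelve. all: by end_near. Qed.

End Module.

Lemma has_ddtZ (V : normedModType R) J (k : R -> R) (f : R -> V) t dk df :
  has_ddt J k t dk -> has_ddt J f t df ->
  has_ddt J (fun u => k u *: f u) t (dk *: f t + k t *: df).
Proof.
move=> hk hf; rewrite /has_ddt (_ : diff_quotient _ _ =
  fun u => diff_quotient k t u *: f u + k t *: diff_quotient f t u).
  apply: cvgD; apply: cvgZ => //; [exact: has_ddt_cvg hf|exact: cvg_cst].
apply/funext => u; have -> : diff_quotient k t u = (u - t)^-1 * (k u - k t) by [].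
rewrite /diff_quotient [RHS]addrC scalerA mulrC -!scalerA -scalerDr.
by congr (_ *: _); rewrite scalerBl scalerBr [RHS]addrC addrA subrK.
Qed.

Lemma has_ddtM J (f g : R -> R) t df dg : has_ddt J f t df -> has_ddt J g t dg ->
  has_ddt J (fun u => f u * g u) t (df * g t + f t * dg).
Proof. exact: has_ddtZ. Qed.

(** Caratheodory's factorisation of [phi] avoids dividing by [f u - f t], which may vanish. *)
Lemma has_ddt_comp J (f phi : R -> R) t df e :
  has_ddt J f t df -> is_derive (f t) 1 phi e ->
  has_ddt J (fun u => phi (f u)) t (e * df).
Proof.
move=> hf /is_derive1_caratheodory[psi [phiE cpsi psiE]].
rewrite /has_ddt (_ : diff_quotient _ _ = fun u => psi (f u) * diff_quotient f t u).
  apply: cvgM => //; rewrite -psiE; apply: continuous_cvg => //.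
  exact: has_ddt_cvg hf.
by apply/funext => u; rewrite /diff_quotient phiE /GRing.scale /= mulrCA.
Qed.

Lemma has_ddt_mxP m n J (f : R -> 'M[R]_(m, n)) t d :
  has_ddt J f t d <-> forall i j, has_ddt J (fun u => f u i j) t (d i j).
Proof.
have E i j u : diff_quotient (fun u => f u i j) t u = (diff_quotient f t u) i j.
  by rewrite /diff_quotient !mxE.
split=> [h i j|h].
  rewrite /has_ddt (_ : diff_quotient _ _ =
    (fun A : 'M[R]_(m, n) => A i j) \o diff_quotient f t).
    by apply: continuous_cvg => //; exact: coord_continuous.
  by apply/funext => u; rewrite E.
move=> A [P dP PA].
(* A neighbourhood of a matrix contains a product of neighbourhoods of its finitely many entries, so
   the entrywise conditions can be intersected. *)
have : \forall u \near within J t^', forall ij : 'I_m * 'I_n,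
    P ij.1 ij.2 (diff_quotient f t u ij.1 ij.2).
  apply: (@filter_forall _ ('I_m * 'I_n)%type
    (fun ij u => P ij.1 ij.2 (diff_quotient f t u ij.1 ij.2))) => -[i j] /=.
  have : \forall u \near within J t^', P i j (diff_quotient (fun v => f v i j) t u).
    exact: h i j _ (dP i j).
  by apply: filterS => u; rewrite E.
by apply: filterS => u Pu; apply: PA => i j; exact: (Pu (i, j)).
Qed.

Lemma has_ddt_mulmx m n p J (f : R -> 'M[R]_(m, n)) (g : R -> 'M[R]_(n, p)) t df dg :
  has_ddt J f t df -> has_ddt J g t dg ->
  has_ddt J (fun u => f u *m g u) t (df *m g t + f t *m dg).
Proof.
move=> /has_ddt_mxP hf /has_ddt_mxP hg; apply/has_ddt_mxP => i j.
rewrite !mxE -big_split /= (_ : (fun u => _) = fun u => \sum_k f u i k * g u k j).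
  by apply: has_ddt_sum => k; exact: has_ddtM.
by apply/funext => u; rewrite mxE.
Qed.

Lemma has_ddt_trmx m n J (f : R -> 'M[R]_(m, n)) t df :
  has_ddt J f t df -> has_ddt J (fun u => (f u)^T) t df^T.
Proof.
move=> /has_ddt_mxP hf; apply/has_ddt_mxP => i j.
rewrite !mxE (_ : (fun u => _) = fun u => f u j i) //.
by apply/funext => u; rewrite mxE.
Qed.

Lemma has_ddt_mxtrace n J (f : R -> 'M[R]_n) t df :
  has_ddt J f t df -> has_ddt J (fun u => \tr (f u)) t (\tr df).
Proof. by move=> /has_ddt_mxP hf; apply: has_ddt_sum => i; exact: hf. Qed.

Lemma has_ddt_scalar_mx n J (f : R -> R) t df :
  has_ddt J f t df -> has_ddt J (fun u => (f u)%:M : 'M[R]_n) t df%:M.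
Proof.
move=> hf; apply/has_ddt_mxP => i j; rewrite !mxE.
rewrite (_ : (fun u => _) = fun u => f u * (i == j)%:R); last first.
  by apply/funext => u; rewrite !mxE mulr_natr.
have := has_ddtM hf (has_ddt_cst J t ((i == j)%:R : R)).
by rewrite mulr0 addr0 mulr_natr.
Qed.

Lemma has_ddt_scale_cst (V : normedModType R) J (k : R) (f : R -> V) t df :
  has_ddt J f t df -> has_ddt J (fun u => k *: f u) t (k *: df).
Proof.
by move=> /(has_ddtZ (has_ddt_cst J t k)); rewrite scale0r add0r.
Qed.

Lemma has_ddtB (V : normedModType R) J (f g : R -> V) t df dg :
  has_ddt J f t df -> has_ddt J g t dg ->
  has_ddt J (fun u => f u - g u) t (df - dg).
Proof.
move=> hf /(has_ddt_scale_cst (k := -1)) hg; have := has_ddtD hf hg.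
rewrite scaleN1r (_ : (fun u => _) = fun u => f u - g u)//.
by apply/funext => u; rewrite scaleN1r.
Qed.

Lemma has_ddt_near_ext (V : normedModType R) J (f g : R -> V) t d : f t = g t ->
  {near within J t^', f =1 g} -> has_ddt J f t d -> has_ddt J g t d.
Proof.
move=> fgt fg; apply: cvg_trans; apply: near_eq_cvg.
by apply: filterS fg => u fgu; rewrite /diff_quotient fgu fgt.
Qed.

Lemma has_ddt_continuous (V : normedModType R) J (f : R -> V) t d :
  has_ddt J f t d -> f @ within J (nbhs t) --> f t.
Proof.
move=> /has_ddt_cvg h P ftP; apply: (@filterS _ (nbhs t) _ _ _ _ (h P ftP)) => u hu Ju.
by have [->|ut] := eqVneq u t; [exact: nbhs_singleton ftP|exact: hu].
Qed.

Lemma is_derive_has_ddt J (f : R -> R) t d : is_derive t 1 f d -> has_ddt J f t d.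
Proof.
have h : has_ddt J (id : R -> R) t 1.
  have : cst (1 : R) @ within J t^' --> (1 : R) by exact: cvg_cst.
  apply: cvg_trans; apply: near_eq_cvg; near=> u.
  rewrite /diff_quotient /GRing.scale /= mulVf// subr_eq0.
  by near: u; apply: cvg_within; exact: withinT.
by move=> /(has_ddt_comp h); rewrite mulr1.
Unshelve. all: by end_near. Qed.

Lemma has_ddt_is_derive J (f : R -> R) t d : (\forall u \near t, J u) ->
  has_ddt J f t d -> is_derive t 1 f d.
Proof.
move=> nJ h; apply/is_derive1_caratheodory.
exists (fun u => if u == t then d else (f u - f t) / (u - t)); rewrite eqxx; split => //.
  move=> z; have [->|zt] := eqVneq z t; first by rewrite !subrr mulr0.
  by rewrite divfK// subr_eq0.
apply/continuous_withinNx; rewrite eqxx => P dP.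
apply: (@filterS2 _ (nbhs t) _ _ _ _ _ nJ (h P dP)) => u Ju hu ut.
by rewrite /= (negbTE ut) mulrC; exact: hu.
Qed.

Section Interval.
Context {J : set R} (J_interval : is_interval J)
  (J_nondeg : exists2 u, J u & u != 0) (J0 : J 0).

Lemma within_proper t : J t -> ProperFilter (within J t^').
Proof.
move=> Jt; have [u Ju u0] := J_nondeg.
have [t0|t0] := eqVneq t 0.
  by apply: (@within_dnbhs_proper _ _ u) => //; rewrite t0.
by apply: (@within_dnbhs_proper _ _ 0) => //; rewrite eq_sym.
Qed.

Lemma has_ddt_unique (V : normedModType R) (f : R -> V) t d1 d2 : J t ->
  has_ddt J f t d1 -> has_ddt J f t d2 -> d1 = d2.
Proof.
move=> Jt; have FF := within_proper Jt => h1 h2.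
exact: cvg_unique h1 h2.
Qed.

Lemma ddtE (V : normedModType R) (f : R -> V) t d : J t ->
  has_ddt J f t d -> ddt J f t = d.
Proof.
move=> Jt h; apply: (has_ddt_unique Jt _ h); apply: derivable_inP.
exact: has_ddt_derivable h.
Qed.

Lemma interior_near a b t : J a -> J b -> a < t < b -> \forall u \near t, J u.
Proof.
move=> Ja Jb /andP[at_ tb]; near=> u; apply: (J_interval Ja Jb).
by apply/andP; split; apply: ltW; near: u; [exact: lt_nbhsr|exact: lt_nbhsl].
Unshelve. all: by end_near. Qed.

(** The mean value theorem asks for ordinary derivatives only inside the segment and for continuity
    within it at the ends, which one-sided derivatives provide. *)
Lemma has_ddt0_cst (h : R -> R) : (forall t, J t -> has_ddt J h t 0) ->
  forall t, J t -> h t = h 0.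
Proof.
move=> hd.
suff H a b : J a -> J b -> a < b -> h a = h b.
  move=> t Jt; have [t0|t0|->//] := ltgtP t 0; first exact: H.
  by apply/esym; exact: H.
move=> Ja Jb ab.
have Jab x : a <= x <= b -> J x by exact: (J_interval Ja Jb).
have : exists2 c, c \in `]a, b[%R & h b - h a = 0 * (b - a).
  apply: (@MVT R h (fun=> 0) a b ab).
    move=> x; rewrite in_itv /= => xab; apply: (@has_ddt_is_derive J).
      exact: (interior_near Ja Jb).
    by apply: hd; apply: Jab; case/andP: xab => /ltW-> /ltW->.
  apply/subspace_continuousP => x /= xab.
  apply: cvg_trans (has_ddt_continuous (hd x _)); last by apply: Jab; rewrite in_itv in xab.
  by apply: cvg_app; apply: within_subset => y /=; rewrite in_itv; exact: Jab.
by case=> c _; rewrite mul0r => /eqP; rewrite subr_eq0 => /eqP.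
Qed.

(** The fundamental theorem asks for two-sided continuity at [t], whereas [f] is continuous only
    within [J]. So [f] is composed with a clamp onto a segment [[al, be]] of [J] that contains 0,
    [t] and all points of [J] near [t]. *)
Lemma has_ddt_oint (f : R -> R) :
  (forall t, J t -> f @ within J (nbhs t) --> f t) ->
  forall t, J t -> has_ddt J (oint f) t (f t).
Proof.
move=> fc t Jt.
(* If [t] is the left end of [J], then [al = t]; otherwise [al] is a point of [J] to the left of
   [t], lowered to 0 if necessary. *)
have [al [Jal al0 alt alJ]] : exists al, [/\ J al, al <= 0, al <= t &
    \forall u \near t, J u -> al <= u].
  have [[s Js st]|nos] := pselect (exists2 s, J s & s < t).
    exists (Num.min s 0); split.
    - by rewrite /Num.min; case: ifP.
    - by rewrite ge_min lexx orbT.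
    - by rewrite ge_min (ltW st).
    - near=> u => _; rewrite ge_min; apply/orP; left; apply: ltW.
      by near: u; exact: lt_nbhsr.
  exists t; split => //.
    by rewrite leNgt; apply/negP => t0; apply: nos; exists 0.
  by near=> u => Ju; rewrite leNgt; apply/negP => ut; apply: nos; exists u.
have [be [Jbe be0 bet beJ]] : exists be, [/\ J be, 0 <= be, t <= be &
    \forall u \near t, J u -> u <= be].
  have [[s Js st]|nos] := pselect (exists2 s, J s & t < s).
    exists (Num.max s 0); split.
    - by rewrite /Num.max; case: ifP.
    - by rewrite le_max lexx orbT.
    - by rewrite le_max (ltW st).
    - near=> u => _; rewrite le_max; apply/orP; left; apply: ltW.
      by near: u; exact: lt_nbhsl.
  exists t; split => //.
    by rewrite leNgt; apply/negP => t0; apply: nos; exists 0.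
  by near=> u => Ju; rewrite leNgt; apply/negP => ut; apply: nos; exists u.
pose clamp u := Num.max al (Num.min be u).
have clampJ u : J (clamp u).
  apply: (J_interval Jal Jbe); rewrite /clamp le_max lexx /= ge_max ge_min lexx /= andbT.
  exact: le_trans alt bet.
have clampE u : al <= u <= be -> clamp u = u.
  by move=> /andP[h1 h2]; rewrite /clamp min_r// max_r//.
have clampc : continuous clamp.
  move=> u; apply: (@continuous_max R R (cst al) (fun u => Num.min be u)).
    exact: cst_continuous.
  by apply: (@continuous_min R R (cst be) id); [exact: cst_continuous|exact: cvg_id].
pose h := f \o clamp.
have hc : continuous h.
  move=> u; apply: cvg_comp (fc _ (clampJ u)).
  move=> P hP; apply: (@filterS _ (nbhs u) _ _ _ _ (clampc u _ hP)) => v Pv.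
  exact: Pv (clampJ v).
have hint x y : lebesgue_measure.-integrable `[x, y] (EFin \o h).
  apply: continuous_compact_integrable; first exact: segment_compact.
  exact: continuous_subspaceT.
(* Starting at [al - 1] puts [t] strictly after the base point even when [t = al]. On [[al, be]] the
   oriented integral is [F - F 0]. *)
pose F x := \int[lebesgue_measure]_(s in `[al - 1, x]) h s.
have FB x y : al <= x -> x <= y -> y <= be ->
    \int[lebesgue_measure]_(s in `[x, y]) f s = F y - F x.
  move=> alx xy ybe; rewrite /F Rintegral_itvB//=; last by rewrite bnd_simp; lra.
  rewrite Rintegral_itv_obnd_cbnd//; last first.
    by apply: integrableS (hint x y) => //; exact: subset_itv_oc_cc.
  apply: eq_Rintegral => s; rewrite inE /= in_itv /= => /andP[xs sy].
  by rewrite /h /= clampE// (le_trans alx xs) (le_trans sy ybe).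
have Fd : is_derive t 1 F (f t).
  have at_ : al - 1 < t by lra.
  have tt1 : t < t + 1 by lra.
  have [dF FE] := continuous_FTC1_closed tt1 (hint (al - 1) (t + 1)) at_ (hc t).
  apply: DeriveDef => //; rewrite -derive1E FE /h /= clampE// alt bet//.
have /has_ddtB/(_ (has_ddt_cst J t (F 0))) := is_derive_has_ddt J Fd.
rewrite subr0; apply: has_ddt_near_ext.
  rewrite /oint; case: ifPn => t0; first by rewrite FB.
  by rewrite FB ?opprB// ltW// ltNge.
near=> u.
have Ju : J u by near: u; exact: withinT.
have alu : al <= u.
  by move: Ju; near: u; apply: cvg_within; apply: nbhs_dnbhs.
have ube : u <= be.
  by move: Ju; near: u; apply: cvg_within; apply: nbhs_dnbhs.
rewrite /oint; case: ifPn => u0; first by rewrite FB.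
by rewrite FB ?opprB// ltW// ltNge.
Unshelve. all: by end_near. Qed.

End Interval.

End HasDdt.

(** * Parallel fields *)

Lemma near_sg (R : realType) (z : R) : z != 0 ->
  \forall y \near z, Num.sg y = Num.sg z.
Proof.
move=> z0; have [z1|z1|z1] := ltgtP z 0.
- by near=> y; rewrite !ltr0_sg//; near: y; exact: lt_nbhsl.
- by near=> y; rewrite !gtr0_sg//; near: y; exact: lt_nbhsr.
- by rewrite z1 eqxx in z0.
Unshelve. all: by end_near. Qed.

Section CurveCalculus.
Context {R : realType}.
Variable G : lie_group.
Local Notation M := 'M[R]_(msize G).
Local Notation alg := (@in_algebra R G).
Implicit Types (J : set R) (t : R) (x y : R -> M).

Lemma has_ddt_inner J x y t dx dy : has_ddt J x t dx -> has_ddt J y t dy ->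
  has_ddt J (fun u => inner (x u) (y u)) t (inner dx (y t) + inner (x t) dy).
Proof.
move=> hx hy; rewrite /inner -mulrDr -raddfD /=.
by apply: has_ddt_scale_cst; apply: has_ddt_mxtrace; exact: has_ddt_mulmx.
Qed.

Lemma has_ddt_bracket J x y t dx dy : has_ddt J x t dx -> has_ddt J y t dy ->
  has_ddt J (fun u => bracket (x u) (y u)) t (bracket dx (y t) + bracket (x t) dy).
Proof.
move=> hx hy; rewrite /bracket addrACA -opprD [_ + dy *m _]addrC.
by apply: has_ddtB; exact: has_ddt_mulmx.
Qed.

Lemma has_ddt_ginv J x t dx : has_ddt J x t dx ->
  has_ddt J (fun u => ginv (x u)) t (ginv dx).
Proof.
rewrite /ginv; case: {+}G x dx => /= x dx hx; last exact: has_ddt_trmx.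
by apply: has_ddtB => //; apply: has_ddt_scalar_mx; exact: has_ddt_mxtrace.
Qed.

(** Near a nonzero value the absolute value is multiplication by a constant sign, so [|<x, x>|] is
    differentiable along the curve whatever its causal type. *)
Lemma has_ddt_inv_norm J x t dx : norm (x t) != 0 -> has_ddt J x t dx ->
  has_ddt J (fun u => (norm (x u))^-1) t
    (- (Num.sg (inner (x t) (x t)) * inner (x t) dx * (norm (x t))^-1 ^+ 3)).
Proof.
move=> nx hx; have q0 : inner (x t) (x t) != 0 by rewrite -norm_neq0.
have := has_ddt_inner hx hx; rewrite innerC => hq.
pose s := Num.sg (inner (x t) (x t)).
have habs : is_derive (inner (x t) (x t)) 1 (fun y : R => `|y|) s.
  apply: (@near_eq_is_derive R R^o R^o (fun y : R => s * y)).
    by apply: filterS (near_sg q0) => y sgy; rewrite [RHS]normrEsg sgy.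
  have h : is_derive (inner (x t) (x t)) 1 (id : R -> R) 1 by exact: is_derive_id.
  have := is_deriveZ s h.
  by rewrite /GRing.scale /= mulr1.
have q1 : 0 < `|inner (x t) (x t)| by rewrite normr_gt0.
have hn := has_ddt_comp (has_ddt_comp hq habs) (is_derive1_sqrt q1).
have h : is_derive (norm (x t)) 1 (id : R -> R) 1 by exact: is_derive_id.
have := has_ddt_comp hn (@is_deriveV R id (norm (x t)) 1 1 nx h).
rewrite -/(norm (x t)) /GRing.scale /= => hN.
congr (has_ddt _ _ _ _) : hN; rewrite /s; field; exact: nx.
Qed.

(** The sign is locally constant away from 0, hence has derivative 0: the zero-derivative criterion
    stands in for a connectedness argument. This keeps the curve on a single pseudosphere. *)
Lemma sg_inner_cst J x : is_interval J -> J 0 -> (exists2 u, J u & u != 0) ->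
  (forall t, J t -> derivable_in J x t) -> (forall t, J t -> norm (x t) != 0) ->
  forall t, J t -> Num.sg (inner (x t) (x t)) = Num.sg (inner (x 0) (x 0)).
Proof.
move=> J_int J0 Jn dx nx.
apply: (has_ddt0_cst J_int J0 (h := fun t => Num.sg (inner (x t) (x t)))) => t Jt.
have q0 : inner (x t) (x t) != 0 by rewrite -norm_neq0 nx.
have hx := derivable_inP (dx t Jt).
rewrite -[X in has_ddt _ _ _ X](mul0r (inner (ddt J x t) (x t) + inner (x t) (ddt J x t))).
apply: (has_ddt_comp (has_ddt_inner hx hx)).
apply: (@near_eq_is_derive R R^o R^o (cst (Num.sg (inner (x t) (x t))))).
  by apply: filterS (near_sg q0) => y ->.
Qed.

Lemma has_ddt_alg J x t dx : is_interval J -> J 0 -> (exists2 u, J u & u != 0) ->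
  (forall t, J t -> alg (x t)) -> J t -> has_ddt J x t dx -> alg dx.
Proof.
move=> J_int J0 Jn; rewrite /in_algebra; case: {+}G x dx => /= x dx hx Jt hd.
  apply: (has_ddt_unique J_int Jn J0 Jt (has_ddt_mxtrace hd)).
  apply: has_ddt_ext (has_ddt_cst J t 0) => // u Ju.
  by rewrite hx.
apply: (has_ddt_unique J_int Jn J0 Jt (has_ddt_trmx hd)).
have := has_ddt_scale_cst (k := -1) hd; rewrite scaleN1r; apply: has_ddt_ext => // u Ju.
by rewrite hx// scaleN1r.
Qed.


(** The component of [dx] along [n] is projected out; the sign stands for [1 / <n, n>]. *)
Lemma has_ddt_normalize J x t dx : norm (x t) != 0 -> has_ddt J x t dx ->
  let n := normalize x t in
  has_ddt J (normalize x) t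
    ((norm (x t))^-1 *: (dx - (Num.sg (inner (x t) (x t)) * inner n dx) *: n)).
Proof.
move=> nx hx /=; have := has_ddtZ (has_ddt_inv_norm nx hx) hx.
congr (has_ddt _ _ _ _); rewrite addrC scalerBr /normalize innerZl.
congr (_ + _); rewrite !scalerA -scaleNr; congr (_ *: _); ring.
Qed.

Section Frame.
Context {J : set R} (J_interval : is_interval J) (J0 : J 0)
  (J_nondeg : exists2 u, J u & u != 0).

Lemma inner_ddt_eq0 x t dx k : J t -> (forall u, J u -> inner (x u) (x u) = k) ->
  has_ddt J x t dx -> inner (x t) dx = 0.
Proof.
move=> Jt xk hx; have := has_ddt_inner hx hx; rewrite (innerC dx).
move=> /(has_ddt_unique J_interval J_nondeg J0 Jt) e.
suff : inner (x t) dx + inner (x t) dx = 0.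
  by move=> /eqP; rewrite -mulr2n mulrn_eq0 /= => /eqP.
by apply: e; apply: has_ddt_ext (has_ddt_cst J t k) => // u Ju; rewrite xk.
Qed.

(* The curve [c] is [n] or [N]. *)
Context {c : R -> M} {eta : R} (c_alg : forall t, J t -> alg (c t))
  (c_derivable : forall t, J t -> derivable_in J c t)
  (c_unit : forall t, J t -> inner (c t) (c t) = eta) (eta_neq0 : eta != 0).

Lemma parallel_inner u v : parallel J c u -> parallel J c v ->
  forall t, J t -> inner (u t) (v t) = inner (u 0) (v 0).
Proof.
move=> hu hv; apply: (has_ddt0_cst J_interval J0 (h := fun t => inner (u t) (v t))) => t Jt.
have [[_ ut] du [mu hmu]] := hu t Jt; have [[_ vt] dv [mv hmv]] := hv t Jt.
have := has_ddt_inner (derivable_inP du) (derivable_inP dv).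
by rewrite hmu hmv innerZl innerZr (innerC (u t)) ut vt !mulr0 addr0.
Qed.

Lemma parallelP u : (forall t, J t -> tangent (c t) (u t)) ->
  (forall t, J t -> exists m, has_ddt J u t (m *: c t)) -> parallel J c u.
Proof.
move=> ut du t Jt; have [m hm] := du t Jt; split; first exact: ut.
  exact: has_ddt_derivable hm.
by exists m; apply: ddtE hm.
Qed.

(** The derivative of [c] and the vector [u] are both orthogonal to [c], so their bracket is normal;
    only [[c, du]] can have a tangential part. *)
Lemma has_ddt_bracket_tangent u t du : J t -> tangent (c t) (u t) ->
  has_ddt J u t du ->
  exists m, has_ddt J (fun s => bracket (c s) (u s)) t (m *: c t + bracket (c t) du).
Proof.
move=> Jt [au cu] hu; have hc := derivable_inP (c_derivable Jt).
have [||||||m hm] := @bracket_orthogonal _ _ (c t) (ddt J c t) (u t).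
- exact: c_alg.
- exact: has_ddt_alg hc.
- by [].
- by rewrite c_unit.
- exact: inner_ddt_eq0 Jt c_unit hc.
- by [].
by exists m; have := has_ddt_bracket hc hu; rewrite hm.
Qed.

Lemma tangent_bracket p q : alg p -> alg q -> tangent p (bracket p q).
Proof. by move=> hp hq; split; [exact: alg_bracket|exact: inner_bracketxl]. Qed.

Lemma parallel_bracket u : parallel J c u -> parallel J c (fun t => bracket (c t) (u t)).
Proof.
move=> hu; apply: parallelP => t Jt; have [ut du [m hm]] := hu t Jt.
  by apply: tangent_bracket; [exact: c_alg|case: ut].
have [k] := has_ddt_bracket_tangent Jt ut (derivable_inP du).
by rewrite hm bracketZr bracketxx scaler0 addr0; exists k.
Qed.

Lemma parallelD u v : parallel J c u -> parallel J c v ->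
  parallel J c (fun t => u t + v t).
Proof.
move=> hu hv; apply: parallelP => t Jt; have [[au ut] du [m hm]] := hu t Jt.
  have [[av vt] _ _] := hv t Jt; split; first exact: algD.
  by rewrite /= innerDr ut vt addr0.
have [_ dv [k hk]] := hv t Jt; exists (m + k); rewrite scalerDl -hm -hk.
by apply: has_ddtD; exact: derivable_inP.
Qed.

Lemma parallelZ k u : parallel J c u -> parallel J c (fun t => k *: u t).
Proof.
move=> hu; apply: parallelP => t Jt; have [[au ut] du [m hm]] := hu t Jt.
  by split; [exact: algZ|rewrite /= innerZr ut mulr0].
by exists (k * m); rewrite -scalerA -hm; apply: has_ddt_scale_cst; exact: derivable_inP.
Qed.

(* Parallel fields have constant inner products, so a parallel field is determined by
   its coordinates at 0 in the parallel frame [P e], [c, P e]. *)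
Lemma parallel_transport_unique P u : parallel_transport J c P -> parallel J c u ->
  forall t, J t -> u t = P t (u 0).
Proof.
move=> hP hu; have cc t : J t -> inner (c t) (c t) != 0 by move=> ?; rewrite c_unit.
have [e [ae ce ee]] := exists_nonnull_orthogonal (c_alg J0) (cc _ J0).
have te : tangent (c 0) e by split.
have [Pe0 parE] := hP e te; set E := P ^~ e in parE.
have E0 : E 0 = e by [].
have parF := parallel_bracket parE; set F := fun t => _ in parF.
have expand v : parallel J c v -> forall t, J t ->
    v t = (inner (E 0) (v 0) / inner (E 0) (E 0)) *: E t
       + (inner (F 0) (v 0) / inner (F 0) (F 0)) *: F t.
  move=> hv t Jt; have [[aE cE] _ _] := parE t Jt; have [[av cv] _ _] := hv t Jt.
  have EE := parallel_inner parE parE Jt.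
  rewrite [LHS](frame_expansion (c_alg Jt) aE av (cc t Jt) _ cE) ?EE ?E0//.
  rewrite cv mul0r scale0r add0r (parallel_inner parE hv Jt) E0.
  by rewrite -[bracket _ _]/(F t) (parallel_inner parF hv Jt) (parallel_inner parF parF Jt).
move=> t Jt; have [tu _ _] := hu 0 J0; have [P0 parP] := hP _ tu.
by rewrite (expand _ hu t Jt) (expand _ parP t Jt) P0.
Qed.

End Frame.

End CurveCalculus.

(** * Bijectivity of the extended transport, curvature coefficients, rotations *)

Section TransportAndRotation.
Context {R : realType}.
Variable G : lie_group.
Local Notation M := 'M[R]_(msize G).
Local Notation alg := (@in_algebra R G).
Implicit Types (J : set R) (t : R).

Section TransportBij.
Context {J : set R} (J_interval : is_interval J) (J0 : J 0)
  (J_nondeg : exists2 u, J u & u != 0).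
Context {c : R -> M} {eta : R} (c_alg : forall t, J t -> alg (c t))
  (c_derivable : forall t, J t -> derivable_in J c t)
  (c_unit : forall t, J t -> inner (c t) (c t) = eta) (eta_neq0 : eta != 0).
Context {P : R -> M -> M} (hP : parallel_transport J c P).

Let unique u := @parallel_transport_unique _ _ _ J_interval J0 J_nondeg _ _ c_alg
  c_derivable c_unit eta_neq0 P u hP.

Let proj_tangent x : alg x ->
  tangent (c 0) (x - (inner (c 0) x / inner (c 0) (c 0)) *: c 0).
Proof.
move=> ax; split; first by apply: algB => //; apply: algZ; exact: c_alg.
by rewrite /= innerBr innerZr divfK ?subrr// c_unit.
Qed.

Lemma transport_ext_combination w r t : tangent (c 0) w -> J t ->
  transport_ext c P t (r *: c 0 + w) = r *: c t + P t w.
Proof.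
move=> [_ cw] Jt; rewrite /transport_ext /lin_ext innerDr innerZr cw addr0.
by rewrite mulfK ?c_unit// [r *: c 0 + w]addrC addrK.
Qed.

Lemma inner_transport_ext x y t : alg x -> alg y -> J t ->
  inner (transport_ext c P t x) (transport_ext c P t y) = inner x y.
Proof.
move=> ax ay Jt.
suff key r w r' w' : tangent (c 0) w -> tangent (c 0) w' ->
    inner (transport_ext c P t (r *: c 0 + w)) (transport_ext c P t (r' *: c 0 + w')) =
    inner (r *: c 0 + w) (r' *: c 0 + w').
  have := key (inner (c 0) x / inner (c 0) (c 0)) _ (inner (c 0) y / inner (c 0) (c 0))
    _ (proj_tangent ax) (proj_tangent ay).
  by rewrite ![_ *: c 0 + _]addrC !subrK.
move=> tw tw'; rewrite !transport_ext_combination//.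
have [P0 parP] := hP tw; have [P0' parP'] := hP tw'.
have [[_ Pt] _ _] := parP t Jt; have [[_ Pt'] _ _] := parP' t Jt.
have [[_ cw] [_ cw']] := (tw, tw').
have /= e := parallel_inner J_interval J0 parP parP' Jt.
rewrite !innerDl !innerDr !innerZl !innerZr (innerC (P t w) (c t)) (innerC w (c 0)).
by rewrite e P0 P0' Pt Pt' cw cw' !c_unit.
Qed.

(** Injectivity comes from the isometry property tested on a frame at 0. For surjectivity, a vector
    at [t] is expanded in the frame [c], [E], [[c, E]] with [E] parallel, and its preimage has the
    same coefficients at 0. *)
Lemma transport_ext_bij t : J t -> set_bij alg alg (transport_ext c P t).
Proof.
move=> Jt; have cc u : J u -> inner (c u) (c u) != 0 by move=> ?; rewrite c_unit.
have [e [ae ce ee]] := exists_nonnull_orthogonal (c_alg J0) (cc _ J0).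
split.
- move=> x ax; have [_ /(_ t Jt)[[aP _] _ _]] := hP (proj_tangent ax).
  by apply: algD => //; apply: algZ; exact: c_alg.
- move=> x y /[!inE] ax ay xy; apply/eqP; rewrite -subr_eq0; apply/eqP.
  have orth z : alg z -> inner z (x - y) = 0.
    move=> az; rewrite innerBr -(inner_transport_ext az ax Jt).
    by rewrite -(inner_transport_ext az ay Jt) xy subrr.
  apply: (orthogonal_frame_eq0 (c_alg J0) ae) => //.
  + exact: algB.
  + exact: cc.
  + by apply: orth; exact: c_alg.
  + exact: orth.
  + by apply: orth; apply: alg_bracket => //; exact: c_alg.
- move=> y ay; have te : tangent (c 0) e by split.
  have [P0 parE] := hP te; set E := P ^~ e in parE.
  have parF := parallel_bracket J_interval J0 J_nondeg c_alg c_derivable c_unit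
    eta_neq0 parE.
  have [[aE cE] _ _] := parE t Jt.
  have EE := parallel_inner J_interval J0 parE parE Jt.
  have E0 : E 0 = e by [].
  have EEt : inner (E t) (E t) != 0 by rewrite EE E0.
  have := frame_expansion (c_alg Jt) aE ay (cc t Jt) EEt cE.
  set r := _ / _; set al := _ / inner (E t) _; set be := inner (bracket _ _) _ / _ => ->.
  have parZ := parallelZ J_interval J0 J_nondeg.
  have par := parallelD J_interval J0 J_nondeg (parZ _ _ al _ parE) (parZ _ _ be _ parF).
  have [tan0 _ _] := par 0 J0.
  exists (r *: c 0 + (al *: E 0 + be *: bracket (c 0) (E 0))).
    apply: algD; first by apply: algZ; exact: c_alg.
    by case: tan0.
  by rewrite transport_ext_combination// -(unique par Jt) addrA.
Qed.

End TransportBij.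

(** Pairing with [[c, c']], which is non-null and orthogonal to the other two frame vectors,
    recovers the coefficient; so [xget] chooses from a singleton. *)
Lemma geodesic_curvatureE J (c : R -> M) t p q k :
  let c' := dds J c c in
  alg (c t) -> alg (c' t) -> inner (c t) (c t) != 0 -> inner (c' t) (c' t) != 0 ->
  inner (c t) (c' t) = 0 ->
  dds J c c' t = p *: c t + q *: c' t + k *: bracket (c t) (c' t) ->
  geodesic_curvature J c t = k.
Proof.
move=> c' ac ac' cc cc' o e; apply: xget_unique; first by exists p, q.
move=> k' [p' [q' e']]; have := inner_frame_neq0 ac ac' o cc cc'.
have coef (x y : M) p1 q1 k1 : inner (bracket x y) (p1 *: x + q1 *: y + k1 *: bracket x y) =
    k1 * inner (bracket x y) (bracket x y) :> R.
  have := inner_bracketxl x y; have := inner_bracketxr x y.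
  move: (bracket _ _) => f h1 h2.
  by rewrite !innerDr !innerZr (innerC f x) (innerC f y) h1 h2 !mulr0 !add0r.
move=> ff; apply: (mulIf ff); rewrite -(coef _ _ p' q') -(coef _ _ p q) -e -e'.
by [].
Qed.

Lemma inner_so3_ge0 (x : 'M[R]_(msize SO3)) : in_algebra SO3 x -> 0 <= inner x x.
Proof.
rewrite /in_algebra /inner /lambda /= => hx.
have -> : x *m x = - (x^T *m x) by rewrite hx mulNmx opprK.
rewrite raddfN /= mulrNN mulr_ge0 ?invr_ge0//.
apply: sumr_ge0 => i _; rewrite mxE; apply: sumr_ge0 => j _.
by rewrite mxE -expr2 sqr_ge0.
Qed.

Lemma sphere_of_sg (p x : M) : alg p -> norm p != 0 -> alg x ->
  inner x x = Num.sg (inner p p) -> sphere G (sphere_of p) x.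
Proof.
rewrite norm_neq0 /sphere /sphere_of => ap pp ax xx; split => //.
case: G p x ap pp ax xx => /= p x ap pp ax; last first.
  by move=> xx; apply: (etrans xx); rewrite gtr0_sg// lt_def pp inner_so3_ge0.
case: ltP => h xx; apply: (etrans xx); first by rewrite ltr0_sg.
by rewrite gtr0_sg// lt_def pp.
Qed.

Lemma is_derive_expRN (x : R) : is_derive x 1 (fun y : R => expR (- y)) (- expR (- x)).
Proof.
have h : is_derive x 1 (-%R : R -> R) (- 1) by exact: is_deriveNid.
have := is_derive1_comp (is_derive_expR (- x)) h; by rewrite mulrN1.
Qed.

Lemma is_derive_cosh (x : R) : is_derive x 1 (@cosh R) (sinh x).
Proof.
have := is_deriveZ 2^-1 (is_deriveD (is_derive_expR x) (is_derive_expRN x)).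
rewrite (_ : _ \*: _ = @cosh R) => [|]; first by rewrite /sinh /GRing.scale /= mulrC.
by apply/funext => y; rewrite /cosh /GRing.scale /= mulrC.
Qed.

Lemma is_derive_sinh (x : R) : is_derive x 1 (@sinh R) (cosh x).
Proof.
have := is_deriveZ 2^-1 (is_deriveB (is_derive_expR x) (is_derive_expRN x)).
rewrite (_ : _ \*: _ = @sinh R) => [|]; first by rewrite /cosh /GRing.scale /= opprK mulrC.
by apply/funext => y; rewrite /sinh /GRing.scale /= mulrC.
Qed.

(** Both [cos, sin] and [cosh, sinh] satisfy [C' = d S], [S' = C] and [C^2 - d S^2 = 1], with
    [d = -1] and [d = 1] respectively. These relations are all that the transport argument uses, so
    it needs no case distinction. *)
Lemma rotation_trig (p0 : M) : alg p0 -> norm p0 != 0 ->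
  exists C S : R -> R, let d := lie_sign G * Num.sg (inner p0 p0) in
  [/\ C 0 = 1 /\ S 0 = 0,
      forall x : R, is_derive x 1 C (d * S x),
      forall x : R, is_derive x 1 S (C x),
      forall x : R, C x ^+ 2 - d * S x ^+ 2 = 1 &
      forall (p : M) phi, rotation (sphere_of p0) p phi =
        lin_ext p p (fun v => C phi *: v + S phi *: bracket p v)].
Proof.
move=> ap0 pp; have {}pp : inner p0 p0 != 0 by rewrite -norm_neq0.
have trig : exists C S : R -> R, let d : R := -1 in
  [/\ C 0 = 1 /\ S 0 = 0,
      forall x : R, is_derive x 1 C (d * S x),
      forall x : R, is_derive x 1 S (C x),
      forall x : R, C x ^+ 2 - d * S x ^+ 2 = 1 &
      forall S', S' = Sphere2 \/ S' = Hyperbolic2 -> forall (p : M) phi, rotation S' p phi =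
        lin_ext p p (fun v => C phi *: v + S phi *: bracket p v)].
  exists cos, sin; split => [|x|x|x|S' [->|->] p phi]; rewrite ?cos0 ?sin0//.
  - by have := is_derive_cos x; rewrite -(mulN1r (sin x)).
  - exact: is_derive_sin.
  - by rewrite mulN1r opprK cos2Dsin2.
have htrig : exists C S : R -> R, let d : R := 1 in
  [/\ C 0 = 1 /\ S 0 = 0,
      forall x : R, is_derive x 1 C (d * S x),
      forall x : R, is_derive x 1 S (C x),
      forall x : R, C x ^+ 2 - d * S x ^+ 2 = 1 &
      forall (p : M) phi, rotation Hyperbolic11 p phi =
        lin_ext p p (fun v => C phi *: v + S phi *: bracket p v)].
  exists cosh, sinh; split => [|x|x|x|//].
  - by rewrite /cosh /sinh oppr0 expR0 subrr mul0r; split => //; field.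
  - by rewrite mul1r; exact: is_derive_cosh.
  - exact: is_derive_sinh.
  - by rewrite /cosh /sinh expRN; field; rewrite gt_eqF ?expR_gt0.
move: ap0 pp trig htrig; rewrite /sphere_of /lie_sign; case: {+}G p0 => /= p0 ap0 pp.
  move=> [C1 [S1 [h1 h2 h3 h4 h5]]] [C2 [S2 H2]].
  have [q|q] := ltP (@inner R SL2 p0 p0) 0.
    by exists C1, S1; rewrite ltr0_sg// mul1r; split => //; apply: h5; right.
  by exists C2, S2; rewrite gtr0_sg ?mul1r// lt_def pp.
move=> [C1 [S1 [h1 h2 h3 h4 h5]]] _.
exists C1, S1; rewrite gtr0_sg ?mulr1; last by rewrite lt_def pp inner_so3_ge0.
by split => //; apply: h5; left.
Qed.

End TransportAndRotation.

(** * Rolling *)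

Section Rolling.
Context {R : realType} {G : lie_group}.
Local Notation M := 'M[R]_(msize G).
Local Notation alg := (@in_algebra R G).
Context {J : set R} {a g : R -> M}
  (J_interval : is_interval J) (J0 : J 0) (J_nondeg : exists2 t, J t & t != 0)
  (a_alg : forall t, J t -> alg (a t))
  (a_smooth : smooth_on J a)
  (a_neq0 : forall t, J t -> norm (a t) != 0)
  (g_sol : solves J a g).
Implicit Types t : R.

Local Notation Gi t := (invmx (g t)).
Local Notation A := (fun t => Ad (Gi t) (a t)).
Local Notation N := (normalize A).
Local Notation n := (normalize a).
Local Notation eta := (Num.sg (inner (a 0) (a 0))).

Let g_group t : J t -> in_group (g t). Proof. by case: g_sol => h _ _; exact: h. Qed.

Let g_unit t : J t -> g t \in unitmx.
Proof. by move=> /g_group; exact: group_unit. Qed.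

Let gi_unit t : J t -> Gi t \in unitmx.
Proof. by move=> /g_unit; rewrite unitmx_inv. Qed.

Let g_ddt t : J t -> has_ddt J g t (a t *m g t).
Proof. by case: g_sol => _ h _ /h[/derivable_inP + <-]. Qed.

(** The formula [ginv] gives differentiability; the value then comes from differentiating
    [g^-1 g = 1]. *)
Lemma has_ddt_group_inv t : J t -> has_ddt J (fun u => Gi u) t (- (Gi t *m a t)).
Proof.
move=> Jt; have hd : has_ddt J (fun u => Gi u) t (ginv (a t *m g t)).
  apply: has_ddt_ext (has_ddt_ginv (g_ddt Jt)) => // u Ju.
  by rewrite invmx_ginv//; exact: g_group.
suff <- : ginv (a t *m g t) = - (Gi t *m a t) by [].
have h1 : has_ddt J (fun u => Gi u *m g u) t 0.
  apply: has_ddt_ext (has_ddt_cst J t (1%:M : M)) => // u Ju.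
  by rewrite mulVmx// g_unit.
have := has_ddt_unique J_interval J_nondeg J0 Jt (has_ddt_mulmx hd (g_ddt Jt)) h1.
move=> /eqP; rewrite addr_eq0 mulmxA -mulNmx => /eqP e.
by rewrite -[LHS](mulmxK (g_unit Jt)) e mulmxK// g_unit.
Qed.

Lemma has_ddt_Ad_inv X t dX : J t -> has_ddt J X t dX ->
  has_ddt J (fun u => Ad (Gi u) (X u)) t (Ad (Gi t) (dX - bracket (a t) (X t))).
Proof.
move=> Jt hX; rewrite (_ : (fun u => _) = fun u => Gi u *m X u *m g u); last first.
  by apply/funext => u; rewrite /Ad invmxK.
have := has_ddt_mulmx (has_ddt_mulmx (has_ddt_group_inv Jt) hX) (g_ddt Jt).
congr (has_ddt _ _ _ _); rewrite /Ad invmxK /bracket opprB.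
rewrite !mulmxDr !mulmxDl mulmxN !mulNmx !mulmxA.
by rewrite [- _ + _]addrC addrAC addrA.
Qed.

Lemma has_ddt_Ad X t dX : J t -> has_ddt J X t dX ->
  has_ddt J (fun u => Ad (g u) (X u)) t
    (Ad (g t) dX + bracket (a t) (Ad (g t) (X t))).
Proof.
move=> Jt hX.
have := has_ddt_mulmx (has_ddt_mulmx (g_ddt Jt) hX) (has_ddt_group_inv Jt).
congr (has_ddt _ _ _ _); rewrite /Ad /bracket.
by rewrite mulmxDl mulmxN !mulmxA [RHS]addrA; congr (_ - _); rewrite addrC.
Qed.

Let a_ddt t : J t -> has_ddt J a t (ddt J a t).
Proof. by move=> Jt; exact: derivable_inP (a_smooth (k := 0) Jt). Qed.

Let a_ddt2 t : J t -> has_ddt J (ddt J a) t (ddt J (ddt J a) t).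
Proof. by move=> Jt; exact: derivable_inP (a_smooth (k := 1) Jt). Qed.

Let a_sg t : J t -> Num.sg (inner (a t) (a t)) = eta.
Proof.
move=> Jt; apply: (sg_inner_cst J_interval J0 J_nondeg _ a_neq0 Jt) => u Ju.
exact: has_ddt_derivable (a_ddt Ju).
Qed.

Let eta_neq0 : eta != 0.
Proof. by rewrite sgr_eq0 -norm_neq0 a_neq0. Qed.

Let n_alg t : J t -> alg (n t).
Proof. by move=> Jt; apply: algZ; exact: a_alg. Qed.

Let n_unit t : J t -> inner (n t) (n t) = eta.
Proof. by move=> Jt; rewrite inner_normalized ?a_sg ?a_neq0. Qed.

Let n_ddt t : J t -> has_ddt J n t (ddt J n t).
Proof.
move=> Jt; apply: derivable_inP; apply: has_ddt_derivable.
exact: has_ddt_normalize (a_neq0 Jt) (a_ddt Jt).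
Qed.

Let aE t : J t -> a t = norm (a t) *: n t.
Proof. by move=> Jt; rewrite /normalize scalerA mulfV ?a_neq0// scale1r. Qed.

Lemma normalize_Ad_inv t : J t -> N t = Ad (Gi t) (n t).
Proof. by move=> Jt; rewrite /normalize AdZ Ad_norm// gi_unit. Qed.

Lemma has_ddt_A t : J t -> has_ddt J A t (Ad (Gi t) (ddt J a t)).
Proof.
by move=> Jt; have := has_ddt_Ad_inv Jt (a_ddt Jt); rewrite bracketxx subr0.
Qed.

Lemma has_ddt_N t : J t -> has_ddt J N t (Ad (Gi t) (ddt J n t)).
Proof.
move=> Jt; have := has_ddt_Ad_inv Jt (n_ddt Jt).
rewrite {1}(aE Jt) bracketZl bracketxx scaler0 subr0; apply: has_ddt_ext => // u Ju.
by rewrite normalize_Ad_inv.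
Qed.

Let N_alg t : J t -> alg (N t).
Proof.
move=> Jt; rewrite normalize_Ad_inv//; apply: Ad_alg; last exact: n_alg.
by apply: in_group_inv; exact: g_group.
Qed.

Let N_unit t : J t -> inner (N t) (N t) = eta.
Proof. by move=> Jt; rewrite normalize_Ad_inv// Ad_inner ?gi_unit// n_unit. Qed.

Lemma in_sphere t : J t -> sphere G (sphere_of (a 0)) (N t) /\
  sphere G (sphere_of (a 0)) (n t).
Proof.
by move=> Jt; split; apply: sphere_of_sg => //;
  [exact: a_alg|exact: a_neq0|exact: N_alg|exact: N_unit
  |exact: a_alg|exact: a_neq0|exact: n_alg|exact: n_unit].
Qed.

Lemma rolls_A : rolls J g A a.
Proof.
move=> t Jt; split; first exact: g_group.
- by split; [exact: has_ddt_derivable (has_ddt_A Jt)|exact: has_ddt_derivable (a_ddt Jt)].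
- by rewrite AdKV// g_unit.
- by rewrite (ddtE J_interval J_nondeg J0 Jt (has_ddt_A Jt)) AdKV// g_unit.
Qed.

Lemma rolls_N : rolls J g N n.
Proof.
move=> t Jt; split; first exact: g_group.
- by split; [exact: has_ddt_derivable (has_ddt_N Jt)|exact: has_ddt_derivable (n_ddt Jt)].
- by rewrite normalize_Ad_inv// AdKV// g_unit.
- by rewrite (ddtE J_interval J_nondeg J0 Jt (has_ddt_N Jt)) AdKV// g_unit.
Qed.

(** The derivative of [n] is an expression in [|a|^-1], [a], [a'] and [n], differentiable once the
    sign in it has been frozen to [eta]. *)
Lemma derivable_ddt_n t : J t -> derivable_in J (ddt J n) t.
Proof.
move=> Jt.
have hr := has_ddt_inv_norm (a_neq0 Jt) (a_ddt Jt).
have hi := has_ddt_scale_cst (k := eta) (has_ddt_inner (n_ddt Jt) (a_ddt2 Jt)).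
have h := has_ddtZ hr (has_ddtB (a_ddt2 Jt) (has_ddtZ hi (n_ddt Jt))).
apply: (@has_ddt_derivable _ _ _ _ _ _ (has_ddt_ext Jt _ h)) => u Ju.
have := has_ddt_normalize (a_neq0 Ju) (a_ddt Ju); rewrite a_sg//.
by move=> /(ddtE J_interval J_nondeg J0 Ju) ->.
Qed.

Lemma geodesic_curvature_rolling (dn_neq0 : forall t, J t -> norm (ddt J n t) != 0) t :
  J t -> geodesic_curvature J N t =
    geodesic_curvature J n t - norm (a t) / norm (ddt J n t).
Proof.
move=> Jt; set v := norm (ddt J n t).
pose n' := dds J n n; have n'E u : n' u = normalize (ddt J n) u by [].
have dn' := derivable_inP (has_ddt_derivable (has_ddt_normalize (dn_neq0 t Jt)
  (derivable_inP (derivable_ddt_n Jt)))).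
rewrite -[normalize _]/n' in dn'.
have an' u : J u -> alg (n' u).
  move=> Ju; apply: algZ; apply: (has_ddt_alg J_interval J0 J_nondeg _ Ju (n_ddt Ju)).
  exact: n_alg.
have nn : inner (n t) (n t) != 0 by rewrite n_unit.
have nn' : inner (n' t) (n' t) != 0.
  by rewrite inner_normalized ?dn_neq0// sgr_eq0 -norm_neq0 dn_neq0.
have o : inner (n t) (n' t) = 0.
  by rewrite innerZr (inner_ddt_eq0 J_interval J0 J_nondeg Jt n_unit (n_ddt Jt)) mulr0.
have aX : alg (dds J n n' t).
  apply: algZ; exact: (has_ddt_alg J_interval J0 J_nondeg an' Jt dn').
have := frame_expansion (n_alg Jt) (an' t Jt) aX nn nn' o.
set p := _ / inner (n t) _; set q := _ / inner (n' t) _; set k := _ / inner (bracket _ _) _.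
move=> e; rewrite (geodesic_curvatureE (n_alg Jt) (an' t Jt) nn nn' o e).
have dN u : J u -> ddt J N u = Ad (Gi u) (ddt J n u).
  by move=> Ju; exact: (ddtE J_interval J_nondeg J0 Ju (has_ddt_N Ju)).
(* [Ad] is an isometry, so [N] and [n] have the same speed and their arc length derivatives
   correspond. *)
have N'E u : J u -> dds J N N u = Ad (Gi u) (n' u).
  by move=> Ju; rewrite /dds dN// Ad_norm ?gi_unit// -AdZ.
have dN' := has_ddt_Ad_inv Jt dn'.
have {}dN' : has_ddt J (dds J N N) t
    (Ad (Gi t) (ddt J n' t - bracket (a t) (n' t))).
  by apply: (has_ddt_ext Jt _ dN') => u Ju; rewrite (N'E _ Ju).
(* The extra term is [- [a, n'] / v], and [a = |a| n] makes it a multiple of the last frame vector: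
   [p] and [q] persist and only [k] changes. *)
have N''E : dds J N (dds J N N) t = p *: N t + q *: dds J N N t +
    (k - norm (a t) / v) *: bracket (N t) (dds J N N t).
  rewrite [LHS]/dds (ddtE J_interval J_nondeg J0 Jt dN') (dN _ Jt) (Ad_norm _ (gi_unit Jt)).
  rewrite (N'E _ Jt) (normalize_Ad_inv Jt) -(Ad_bracket _ _ (gi_unit Jt)) -!AdZ -!AdD.
  congr (Ad _ _); rewrite scalerBr -[v^-1 *: ddt J n' t]/(dds J n n' t) e.
  rewrite scalerBl addrA; congr (_ - _).
  by rewrite {1}(aE Jt) bracketZl scalerA mulrC.
apply: (geodesic_curvatureE _ _ _ _ _ N''E).
- exact: N_alg.
- rewrite N'E//; apply: Ad_alg; last exact: an'.
  by apply: in_group_inv; exact: g_group.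
- by rewrite N_unit.
- by rewrite N'E// Ad_inner ?gi_unit.
- by rewrite N'E// normalize_Ad_inv// Ad_inner ?gi_unit.
Qed.


Let Phi := oint (fun t => norm (a t)).

Let Phi_ddt t : J t -> has_ddt J Phi t (norm (a t)).
Proof.
apply: has_ddt_oint => // u Ju; apply: (@has_ddt_continuous _ _ _ (fun u => norm (a u))).
(* Continuity of [|a|] is obtained by inverting the differentiable function [|a|^-1]. *)
have nV : (norm (a u))^-1 != 0 by rewrite invr_eq0 a_neq0.
have h : is_derive (norm (a u))^-1 1 (id : R -> R) 1 by exact: is_derive_id.
have := has_ddt_comp (has_ddt_inv_norm (a_neq0 Ju) (a_ddt Ju))
  (@is_deriveV R id _ 1 1 nV h).
by apply: has_ddt_ext => // s _; rewrite invrK.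
Qed.

(** Both transports thus start in the same tangent space, where the rotation acts. *)
Let N0 : N 0 = n 0.
Proof.
rewrite normalize_Ad_inv//; case: g_sol => _ _ ->.
by rewrite /Ad invmxK invmx1 mul1mx mulmx1.
Qed.

Section Transport.
Context {Pn PN : R -> M -> M} (hPn : parallel_transport J n Pn)
  (hPN : parallel_transport J N PN).
Context {C S : R -> R}.
Let d : R := lie_sign G * eta.
Hypotheses (CS0 : C 0 = 1 /\ S 0 = 0)
  (C_derive : forall x : R, is_derive x 1 C (d * S x))
  (S_derive : forall x : R, is_derive x 1 S (C x))
  (C2S2 : forall x : R, C x ^+ 2 - d * S x ^+ 2 = 1).

Let n_derivable t (Jt : J t) := has_ddt_derivable (n_ddt Jt).

(** On the tangent plane [[n, .]] is a complex structure when [d = -1] and a product structure when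
    [d = 1]. *)
Let bracket_n2 t v : J t -> tangent (n t) v -> bracket (n t) (bracket (n t) v) = d *: v.
Proof.
move=> Jt [av nv]; rewrite double_bracket//; [|exact: n_alg|exact: n_alg].
by rewrite nv scale0r subr0 n_unit// scalerA.
Qed.

(* The rotation undoes the term [|a| [n, W]] by which the derivative of [W] fails to be
   normal, so that [X] is parallel along [n]. *)
Lemma Ad_transport w t : tangent (n 0) w -> J t ->
  Ad (g t) (PN t w) = C (Phi t) *: Pn t w + S (Phi t) *: bracket (n t) (Pn t w).
Proof.
move=> tw Jt; have tNw : tangent (N 0) w by rewrite N0.
have [PN0 parV] := hPN tNw.
pose W u := Ad (g u) (PN u w).
have tanW u : J u -> tangent (n u) (W u).
  move=> Ju; have [[aV NV] _ _] := parV u Ju; split.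
    by apply: Ad_alg => //; exact: g_group.
  have nE : n u = Ad (g u) (N u) by rewrite normalize_Ad_inv// AdKV// g_unit.
  have e : inner (n u) (W u) = inner (N u) (PN u w).
    by rewrite nE /W (Ad_inner _ _ (g_unit Ju)).
  exact: etrans e NV.
have dW u : J u -> exists m, has_ddt J W u (m *: n u + norm (a u) *: bracket (n u) (W u)).
  move=> Ju; have [_ /derivable_inP dV [m hm]] := parV u Ju; exists m.
  have := has_ddt_Ad Ju dV.
  rewrite hm (AdZ (g u) m) (normalize_Ad_inv Ju) (AdKV _ (g_unit Ju)).
  by rewrite -/(W u) [X in bracket X _](aE Ju) bracketZl.
(* [C - S [n, .]] is inverse to [C + S [n, .]] on the tangent plane because [C^2 - d S^2 = 1]. *)
pose X u := C (Phi u) *: W u - S (Phi u) *: bracket (n u) (W u).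
have parX : parallel J n X.
  apply: parallelP => // u Ju; have [aW nW] := tanW u Ju.
    split; first by apply: algB; apply: algZ => //; apply: alg_bracket => //; exact: n_alg.
    by rewrite /= innerBr !innerZr nW inner_bracketxl !mulr0 subrr.
  have [m hm] := dW u Ju.
  have [k hk] := has_ddt_bracket_tangent J_interval J0 J_nondeg n_alg n_derivable n_unit
    eta_neq0 Ju (tanW u Ju) hm.
  have hC := has_ddt_comp (Phi_ddt Ju) (C_derive (Phi u)).
  have hS := has_ddt_comp (Phi_ddt Ju) (S_derive (Phi u)).
  (* The tangential terms [d |a| S W] and [|a| C [n, W]] each occur twice with opposite signs; the
     normal ones add up to this multiple of [n]. *)
  exists (C (Phi u) * m - S (Phi u) * k).
  have := has_ddtB (has_ddtZ hC hm) (has_ddtZ hS hk).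
  congr (has_ddt _ _ _ _).
  rewrite bracketDr (bracketZr m) bracketxx scaler0 add0r (bracketZr (norm (a u))).
  rewrite (bracket_n2 Ju (tanW u Ju)).
  move: (bracket _ _) => f; apply/matrixP => i j; rewrite !mxE; ring.
have X0 : X 0 = w.
  have [C0 S0] := CS0; rewrite /X /Phi /oint lexx set_itv1 Rintegral_set1 C0 S0.
  rewrite scale1r scale0r subr0 /W PN0; case: g_sol => _ _ ->.
  by rewrite /Ad invmx1 mul1mx mulmx1.
have XE := parallel_transport_unique J_interval J0 J_nondeg n_alg n_derivable n_unit
  eta_neq0 hPn parX Jt.
(* Uniqueness identifies [X] with the transport of [w] along [n]; applying [C + S [n, .]] to it
   recovers [W]. *)
rewrite X0 in XE; rewrite -XE /X -/(W t) bracketBr (bracketZr (C _))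
  (bracketZr (S _)) (bracket_n2 Jt (tanW t Jt)).
have := C2S2 (Phi t); move: (bracket _ _) (C _) (S _) => f c s cs.
rewrite -[LHS]scale1r -cs; apply/matrixP => i j; rewrite !mxE; ring.
Qed.

(** [parallel_transport] does not postulate linearity. Both sides are values at [t] of parallel
    fields with the same initial vector, so uniqueness yields it, along with commutation with
    [[n, .]]. *)
Lemma transport_combination w c s t : tangent (n 0) w -> J t ->
  Pn t (c *: w + s *: bracket (n 0) w) = c *: Pn t w + s *: bracket (n t) (Pn t w).
Proof.
move=> tw Jt; have [P0 par] := hPn tw.
have parB := parallel_bracket J_interval J0 J_nondeg n_alg n_derivable n_unit eta_neq0 par.
have parZ := @parallelZ _ _ _ J_interval J0 J_nondeg n.
have parDZ := parallelD J_interval J0 J_nondeg (parZ c _ par) (parZ s _ parB).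
have := parallel_transport_unique J_interval J0 J_nondeg n_alg n_derivable n_unit
  eta_neq0 hPn parDZ Jt.
by rewrite P0.
Qed.

(** The factorisation of [Ad] with the transport along [N] moved to the left side, so that no
    inverse occurs. It is checked on the component of [z] along [N 0 = n 0] and on its tangential
    part. *)
Lemma Ad_transport_ext z t : alg z -> J t ->
  Ad (g t) (transport_ext N PN t z) =
  transport_ext n Pn t (lin_ext (n 0) (n 0)
    (fun v => C (Phi t) *: v + S (Phi t) *: bracket (n 0) v) z).
Proof.
move=> az Jt; rewrite /lin_ext.
set r := _ / _; set w := z - _.
have tw : tangent (n 0) w.
  split; first by apply: algB => //; apply: algZ; exact: n_alg.
  by rewrite /w /r /= innerBr innerZr divfK ?subrr// n_unit.
have zE : z = r *: N 0 + w by rewrite N0 /w addrC subrK.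
rewrite {1}zE (transport_ext_combination J0 N_unit eta_neq0)//; last by rewrite N0.
rewrite (transport_ext_combination J0 n_unit eta_neq0)//; last first.
  case: tw => aw nw; split.
    by apply: algD; apply: algZ => //; apply: alg_bracket => //; exact: n_alg.
  by rewrite /= innerDr !innerZr nw inner_bracketxl !mulr0 addr0.
rewrite transport_combination// AdD AdZ Ad_transport// normalize_Ad_inv//.
by rewrite AdKV// g_unit.
Qed.

End Transport.

Lemma transport_ext_N_bij PN t : parallel_transport J N PN -> J t ->
  set_bij alg alg (transport_ext N PN t).
Proof.
move=> hPN Jt.
apply: (transport_ext_bij J_interval J0 J_nondeg N_alg _ N_unit eta_neq0 hPN Jt).
by move=> u Ju; exact: has_ddt_derivable (has_ddt_N Ju).
Qed.

End Rolling.

Theorem theorem3 (R : realType) (G : lie_group) (J : set R)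
  (a g : R -> 'M[R]_(msize G))
  (J_interval : is_interval J) (J0 : J 0) (J_nondeg : exists2 t, J t & t != 0)
  (a_alg : forall t, J t -> in_algebra G (a t))
  (a_smooth : smooth_on J a)
  (a_neq0 : forall t, J t -> norm (a t) != 0)
  (g_sol : solves J a g) :
  let A := fun t => Ad (invmx (g t)) (a t) in
  let N := normalize A in
  let n := normalize a in
  let S := sphere_of (a 0) in
  let Phi := oint (fun t => norm (a t)) in
  [/\ forall t, J t -> sphere G S (N t) /\ sphere G S (n t),
      rolls J g A a /\ rolls J g N n,
      (forall t, J t -> norm (ddt J n t) != 0) ->
        forall t, J t ->
          geodesic_curvature J N t =
          geodesic_curvature J n t - norm (a t) / norm (ddt J n t)
    & forall Pn PN : R -> 'M[R]_(msize G) -> 'M[R]_(msize G),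
        parallel_transport J n Pn -> parallel_transport J N PN ->
        forall t, J t ->
          set_bij (in_algebra G) (in_algebra G) (transport_ext N PN t) /\
          forall x, in_algebra G x ->
            Ad (g t) x =
            (transport_ext n Pn t \o rotation S (n 0) (Phi t)
               \o 'pinv_(fun=> 0) (in_algebra G) (transport_ext N PN t)) x].
Proof.
move=> A N n S Phi; split.
- exact: (in_sphere J_interval J0 J_nondeg a_alg a_smooth a_neq0 g_sol).
- split; first exact: (rolls_A J_interval J0 J_nondeg a_smooth g_sol).
  exact: (rolls_N J_interval J0 J_nondeg a_smooth a_neq0 g_sol).
- exact: (geodesic_curvature_rolling J_interval J0 J_nondeg a_alg a_smooth a_neq0 g_sol).
move=> Pn PN hPn hPN t Jt.
have bij : set_bij (in_algebra G) (in_algebra G) (transport_ext N PN t).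
  exact: (transport_ext_N_bij J_interval J0 J_nondeg a_alg a_smooth a_neq0 g_sol hPN).
split=> // x ax.
have [C [S' [CS0 dC dS C2S2 rotE]]] := rotation_trig (a_alg _ J0) (a_neq0 _ J0).
(* Bijectivity makes ['pinv_] a true inverse on the algebra: its value at [x] is again in the
   algebra and is a preimage of [x]. *)
have /= ap := bijpinv_bij (fun=> 0) bij.
have az : in_algebra G ('pinv_(fun=> 0) (in_algebra G) (transport_ext N PN t) x).
  by case: ap => h _ _; exact: h.
rewrite /= rotE -(Ad_transport_ext J_interval J0 J_nondeg a_alg a_smooth a_neq0 g_sol
  hPn hPN CS0 dC dS C2S2 az Jt).
case: bij => _ _ surj; congr (Ad _ _); apply/esym.
by apply: (surjpK (fun=> 0) surj); rewrite inE.
Qed.
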